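(* Assume that $A(S)\subseteq \mathrm{ri}(\mathrm{dom}\, g)$, that $\inf_{x\in S}F(x)>-\infty$, that $K(S)\subseteq \mathrm{ri}(\mathrm{dom}\, f)$, and that $r>0$ is such that $\mathcal K_r:=\{z\in\mathbb R^s: \mathrm{dist}(z,A(S))\le r\}\subseteq \mathrm{int}(\mathrm{dom}\, g)$; let $\ell_{g,\mathcal K_r}>0$ be the Lipschitz constant of $g$ on $\mathcal K_r$. For $0<\gamma\le \frac{2r}{\ell_{g,\mathcal K_r}}$ and $\|z^0\|\le \ell_{g,\mathcal K_r}$, let $(x^k,y^k,z^k)_{k\ge0}$ be the sequence generated by the Adaptive DPFS algorithm (described in the context), where the scalar sequences $(\alpha_k)_{k\ge0}$, $(\beta_k)_{k\ge0}$, $(\delta_k)_{k\ge0}$ and $(\rho_k)_{k\ge0}$ are chosen such that the conditions (P1)-(P5) listed in the context are satisfied. Assume in addition that $g$ is essentially strictly convex and $\mathrm{int}(\mathrm{dom}\, f)\ne\emptyset$. Let $0<\varepsilon\le r$ (with $\varepsilon$ the tolerance used in the algorithm) and let $\ell_{g,\mathcal K_\varepsilon}>0$ be the Lipschitz constant of $g$ on the compact set $\mathcal K_\varepsilon=\{z\in\mathbb R^s:\mathrm{dist}(z,A(S))\le\varepsilon\}\subseteq \mathrm{int}(\mathrm{dom}\, g)$. Suppose that the function $\varpi$ (defined in the context) satisfies the Kurdyka-Łojasiewicz property at every point $(x,y,z,u)\in\mathrm{dom}\,\partial\varpi$. Then $(x^k,y^k,z^k)_{k\ge0}$ converges to a $(2\ell_{g,\mathcal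 K_\varepsilon}\varepsilon)$-approximate KKT point of the problem $\min_{x\in S}F(x)$.
   Context: Setting. $S\subseteq\mathbb R^n$ is nonempty, convex and compact; $f:\mathbb R^p\to\mathbb R\cup\{\pm\infty\}$ and $g:\mathbb R^s\to\mathbb R\cup\{\pm\infty\}$ are proper, convex and lower semicontinuous; $A:\mathbb R^n\to\mathbb R^s$ and $K:\mathbb R^n\to\mathbb R^p$ are linear with adjoints $A^*,K^*$; $\varphi:\mathbb R^n\to\mathbb R$ is differentiable with $\ell_{\nabla\varphi}$-Lipschitz continuous gradient. $F(x):=g(Ax)+\varphi(x)-f(Kx)$. $\sigma_A:=\|A\|^2$ is the largest eigenvalue of $A^*A$. $\mathrm{dom}\,h=\{x:h(x)<+\infty\}$; $\mathrm{ri}$ and $\mathrm{int}$ denote relative interior and interior; $\mathrm{dist}(z,C)=\inf_{c\in C}\|z-c\|$; $h^*$ is the Fenchel conjugate of $h$; $\mathrm{Proj}_S$ is the projection onto $S$; $\iota_S$ is the indicator function of $S$; $\mathrm{Prox}_{h,t}(w):=\arg\min_x\{h(x)+\frac1{2t}\|x-w\|^2\}$; $N_S$ is the normal cone of $S$. A proper function is essentially strictly convex if it is strictly convex on every nonempty convex subset of the domain of its subdifferential. For $\epsilon\ge0$ and convex $h$ with $h(\bar x)\in\mathbb R$, $\partial_\epsilon h(\bar x):=\{v: h(x)\ge h(\bar x)+\langle v,x-\bar x\rangle-\epsilon\ \forall x\}$ (empty if $h(\bar x)\notin\mathbb R$), and $\partial h:=\partial_0h$ for convex $h$. A triple $(\bar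 x,\bar y,\bar z)\in\mathbb R^n\times\mathbb R^p\times\mathbb R^s$ is an $\epsilon$-approximate KKT point of $\min_{x\in S}F(x)$ if $A\bar x\in\partial_\epsilon g^*(\bar z)$, $K\bar x\in\partial f^*(\bar y)$ and $K^*\bar y\in A^*\bar z+\nabla\varphi(\bar x)+N_S(\bar x)$. Parameter conditions (with $\gamma>0$, $\frac\gamma2>\alpha>0$, $\mu>0$): (P1) $\lim_{k\to+\infty}\alpha_k=\alpha$ and $\alpha+\gamma\ge\alpha_0\ge\alpha_k\ge\alpha_{k+1}>\alpha$ for all $k\ge0$; (P2) $\frac{\alpha_k-\alpha_{k+1}}{(\alpha_{k+1}-\alpha)(\alpha_k-\alpha)}\le\frac1\gamma$ and $(\alpha_k-\alpha)(\alpha_{k+2}-\alpha)\ge(\alpha_{k+1}-\alpha)^2$ for all $k\ge0$; (P3) $+\infty>\overline\beta\ge\beta_k\ge\underline\beta>0$ for all $k\ge0$; (P4) $\delta_k:=\frac{\alpha}{\alpha_k}$ for all $k\ge0$; (P5) $\rho_k:=\frac{\ell_{\nabla\varphi}}2+\frac{3\sigma_A\gamma}{2(\alpha_k-\alpha)^2}+\mu$ for all $k\ge0$. Adaptive DPFS. Given $\ell_{\nabla\varphi}>0$, $\sigma_A>0$, choose $\beta_0>0$, $\rho_0>0$, $0<\alpha<\frac\gamma2$, $\alpha_0=\alpha+\gamma$, $\delta_0=\frac\alpha{\alpha_0}$, $\mu>0$, $\varepsilon>0$ and a starting point $(x^0,y^0,z^0)$. For $k=0,1,2,\dots$: $x^{k+1}:=\mathrm{Proj}_S\big(x^k+\frac1{\rho_k}(-\nabla\varphi(x^k)+K^*y^k-A^*z^k)\big)$,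 $y^{k+1}:=\mathrm{Prox}_{f^*,1/\beta_k}(y^k+\frac1{\beta_k}Kx^{k+1})$, $z^{k+1}:=\mathrm{Prox}_{g^*,1/\alpha_k}(\delta_kz^k+\frac1{\alpha_k}Ax^{k+1})$; if $(\alpha_k-\alpha)\|z^{k+1}\|>\varepsilon$, then update $\alpha_{k+1}$ according to (P1) and (P2), and set $\rho_{k+1}:=\frac{\ell_{\nabla\varphi}}2+\frac{3\gamma\sigma_A}{2(\alpha_{k+1}-\alpha)^2}+\mu$, $\delta_{k+1}:=\frac\alpha{\alpha_{k+1}}$; otherwise set $\alpha_{k+1}:=\alpha_k$, $\rho_{k+1}:=\rho_k$, $\delta_{k+1}:=\delta_k$. In either case update $\beta_{k+1}$ dynamically to satisfy (P3). Merit function. Let $K_0\ge0$ be an index and $\widetilde\alpha>\alpha>0$ the constant (given by the result that the algorithm is well-defined) such that for all $k\ge K_0$: $\alpha_k=\widetilde\alpha$, $\rho_k=\frac{\ell_{\nabla\varphi}}2+\frac{3\sigma_A\gamma}{2(\widetilde\alpha-\alpha)^2}+\mu$, $\delta_k=\frac\alpha{\widetilde\alpha}$ and $(\alpha_k-\alpha)\|z^{k+1}\|\le\varepsilon$. With this $\widetilde\alpha$, $$\varpi(x,y,z,u):=\langle z,Ax\rangle-g^*(z)+\varphi(x)+\iota_S(x)-\langle Kx,y\rangle+f^*(y)+\frac\alpha2\Big(1+\frac{4\alpha}{\widetilde\alpha-\alpha}\Big)\|z-u\|^2-\frac12(\widetilde\alpha-\alpha)\|z\|^2 .$$ Subdifferential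 and KL property. For an extended-real-valued $h$ and $\bar w$ with $h(\bar w)\in\mathbb R$, the Fréchet subdifferential is $\widehat\partial h(\bar w)=\{v:\liminf_{w\to\bar w,w\ne\bar w}\frac{h(w)-h(\bar w)-\langle v,w-\bar w\rangle}{\|w-\bar w\|}\ge0\}$ and the limiting subdifferential $\partial h(\bar w)$ is the set of limits $v$ of sequences $v^k\in\widehat\partial h(w^k)$ with $w^k\to\bar w$, $h(w^k)\to h(\bar w)$; both are empty if $h(\bar w)\notin\mathbb R$. $\mathrm{dom}\,\partial h=\{w:\partial h(w)\neq\emptyset\}$. A proper function $h$ satisfies the Kurdyka-Łojasiewicz (KL) property at $\widehat w\in\mathrm{dom}\,\partial h$ if there are $\eta\in(0,+\infty]$, an open neighborhood $U$ of $\widehat w$ and a concave continuous $\phi:[0,\eta)\to[0,+\infty)$ with $\phi(0)=0$, $\phi$ continuously differentiable on $(0,\eta)$ with $\phi'>0$ there, such that $\phi'(h(w)-h(\widehat w))\,\mathrm{dist}(0,\partial h(w))\ge1$ for all $w\in U$ with $h(\widehat w)<h(w)<h(\widehat w)+\eta$. For $h=\varpi$, the neighborhood $U$ is restricted so that $U\subseteq\mathbb R^n\times\mathbb R^p\times\mathrm{int}(\mathrm{dom}\, g^* )\times\mathbb R^s$, where $\varpi$ is lower semicontinuous (one has $\mathrm{dom}\,\partial\varpi\subseteq\mathbb R^n\times\mathbb R^p\times\mathrm{int}(\mathrm{dom}\, g^* )\times\mathbb R^s$ when $g$ is essentially strictly convex). *)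

(* Defs.v *)
From HB Require Import structures.
From mathcomp Require Import all_boot all_order all_algebra.
From mathcomp Require Import all_classical all_reals all_analysis.
Set Implicit Arguments.
Unset Strict Implicit.
Unset Printing Implicit Defensive.
Import Order.TTheory GRing.Theory Num.Theory.
Import numFieldNormedType.Exports.
Local Open Scope classical_set_scope.
Local Open Scope ring_scope.

(* R^n is 'cV[R]_n and a linear map R^n -> R^s is a matrix A : 'M[R]_(s, n)
   acting by x |-> A *m x, with adjoint A^T.  The library norm on matrices is
   the sup norm: it supplies the topology and differentiability, whereas every
   metric quantity below uses the Euclidean norm [enorm]. *)

Section Euclidean.
Context {R : realType}.

Definition dot {m} (u v : 'cV[R]_m) : R := \sum_i u i 0 * v i 0.

Definition enorm {m} (u : 'cV[R]_m) : R := Num.sqrt (dot u u).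

Definition dist_to {m} (z : 'cV[R]_m) (C : set 'cV[R]_m) : \bar R :=
  ereal_inf [set (enorm (z - c))%:E | c in C].

Definition opnorm {s n} (A : 'M[R]_(s, n)) : R :=
  sup [set enorm (A *m x) | x in [set x | enorm x <= 1]].

Definition sigma {s n} (A : 'M[R]_(s, n)) : R := opnorm A ^+ 2.

Definition gradient {n} (phi : 'cV[R]_n -> R) (x : 'cV[R]_n) : 'cV[R]_n :=
  \col_i 'D_(delta_mx i 0) phi x.

Definition affine_set {m} (M : set 'cV[R]_m) : Prop :=
  forall x y (t : R), M x -> M y -> M (t *: x + (1 - t) *: y).

Definition affine_hull {m} (C : set 'cV[R]_m) : set 'cV[R]_m :=
  smallest affine_set C.

Definition relint {m} (C : set 'cV[R]_m) : set 'cV[R]_m :=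
  [set x | C x /\ within (affine_hull C) (nbhs x) C].

End Euclidean.

Section ExtendedRealFunctions.
Context {R : realType} {m : nat}.
Implicit Types (h : 'cV[R]_m -> \bar R) (x v w : 'cV[R]_m).
Local Open Scope ereal_scope.

Definition edom h : set 'cV[R]_m := [set x | h x < +oo].

Definition eproper h : Prop :=
  (forall x, -oo < h x) /\ (exists x, h x < +oo).

(* Only used for functions that never take the value -oo. *)
Definition econvex h : Prop := forall x y (t : R), (0 < t < 1)%R ->
  h (t *: x + (1 - t) *: y)%R <= t%:E * h x + (1 - t)%:E * h y.

Definition proper_convex_lsc h : Prop :=
  [/\ eproper h, econvex h & lower_semicontinuous h].

Definition conjugate h : 'cV[R]_m -> \bar R :=
  fun y => ereal_sup [set (dot y x)%:E - h x | x in setT].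

Definition indicator_of (S : set 'cV[R]_m) : 'cV[R]_m -> \bar R :=
  fun x => if x \in S then 0 else +oo.

Definition argmin (D : set 'cV[R]_m) h : set 'cV[R]_m :=
  [set x | D x /\ forall y, D y -> h x <= h y].

Definition proj_on (S : set 'cV[R]_m) w : set 'cV[R]_m :=
  argmin S (fun c => (enorm (c - w))%:E).

Definition prox h (t : R) w : set 'cV[R]_m :=
  argmin setT (fun x => h x + ((2 * t)^-1 * enorm (x - w) ^+ 2)%:E).

Definition eps_subdiff h (eps : R) x : set 'cV[R]_m :=
  [set v | h x \is a fin_num /\
    forall y, h y >= h x + (dot v (y - x))%:E - eps%:E].

Definition subdiff h : 'cV[R]_m -> set 'cV[R]_m := eps_subdiff h 0.

Definition normal_cone (S : set 'cV[R]_m) x : set 'cV[R]_m :=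
  [set v | S x /\ forall c, S c -> (dot v (c - x) <= 0)%R].

Definition essentially_strictly_convex h : Prop :=
  forall C : set 'cV[R]_m, C !=set0 -> convex_set C ->
    C `<=` [set x | subdiff h x !=set0] ->
  forall x y (t : R), C x -> C y -> x != y -> (0 < t < 1)%R ->
    h (t *: x + (1 - t) *: y)%R < t%:E * h x + (1 - t)%:E * h y.

(* [l] is a Lipschitz constant of [h] on [C] *)
Definition lipschitz_const_on (C : set 'cV[R]_m) h (l : R) : Prop :=
  forall x y, C x -> C y -> `|h x - h y| <= (l * enorm (x - y))%:E.

Definition frechet_subdiff h x : set 'cV[R]_m :=
  [set v | h x \is a fin_num /\
    0 <= limf_einf (fun w => (h w - h x - (dot v (w - x))%:E)
                             * ((enorm (w - x))^-1)%:E) x^'].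

Definition limiting_subdiff h x : set 'cV[R]_m :=
  [set v | h x \is a fin_num /\
    exists ws vs : nat -> 'cV[R]_m,
    [/\ forall k, frechet_subdiff h (ws k) (vs k),
        ws @ \oo --> x,
        (h \o ws) @ \oo --> h x &
        vs @ \oo --> v]].

Definition dom_limiting_subdiff h : set 'cV[R]_m :=
  [set x | limiting_subdiff h x !=set0].

(* Concave continuous phi : [0, eta[ -> [0, +oo[ with phi 0 = 0, C^1 on
   ]0, eta[ with positive derivative; values of [phi] elsewhere are
   irrelevant. *)
Definition desingularizing (eta : \bar R) (phi : R -> R) : Prop :=
  let D := [set t : R | (0 <= t)%R /\ t%:E < eta] in
  ([/\ phi 0 = 0,
      (forall t, D t -> 0 <= phi t),
      {within D, continuous phi},
      (forall s t (l : R), D s -> D t -> 0 <= l <= 1 ->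
        l * phi s + (1 - l) * phi t <= phi (l * s + (1 - l) * t)) &
      (forall t : R, 0 < t -> (t%:E < eta)%E ->
        [/\ derivable phi t 1, {for t, continuous (derive1 phi)} &
            0 < derive1 phi t])])%R.

Definition KL_property (D : set 'cV[R]_m) h w0 : Prop :=
  exists (eta : \bar R) (U : set 'cV[R]_m) (phi : R -> R),
  [/\ 0 < eta, open_nbhs w0 U, U `<=` D, desingularizing eta phi &
    forall w, U w -> h w0 < h w < h w0 + eta ->
      1 <= (derive1 phi (fine (h w - h w0)))%:E * dist_to 0 (limiting_subdiff h w)].

End ExtendedRealFunctions.

Section DPFS.
Context {R : realType} {n p s : nat}.
Variables (S : set 'cV[R]_n).
Variables (f : 'cV[R]_p -> \bar R) (g : 'cV[R]_s -> \bar R).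
Variables (A : 'M[R]_(s, n)) (K : 'M[R]_(p, n)) (phi : 'cV[R]_n -> R).

Definition objective (x : 'cV[R]_n) : \bar R :=
  (g (A *m x) + (phi x)%:E - f (K *m x))%E.

Definition enlargement (r : R) : set 'cV[R]_s :=
  [set z | (dist_to z [set A *m x | x in S] <= r%:E)%E].

Definition approx_KKT (eps : R)
    (x : 'cV[R]_n) (y : 'cV[R]_p) (z : 'cV[R]_s) : Prop :=
  [/\ eps_subdiff (conjugate g) eps z (A *m x),
      subdiff (conjugate f) y (K *m x) &
      exists2 v, normal_cone S x v & K^T *m y = A^T *m z + gradient phi x + v].

Definition P1 (alpha gamma : R) (a : nat -> R) : Prop :=
  a @ \oo --> alpha /\
  forall k, [/\ alpha + gamma >= a 0%N, a 0%N >= a k, a k >= a k.+1 &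
                a k.+1 > alpha].

Definition P2 (alpha gamma : R) (a : nat -> R) : Prop := forall k,
  (a k - a k.+1) / ((a k.+1 - alpha) * (a k - alpha)) <= gamma^-1 /\
  (a k - alpha) * (a k.+2 - alpha) >= (a k.+1 - alpha) ^+ 2.

Definition P3 (beta : nat -> R) : Prop :=
  exists lo hi : R, 0 < lo /\ forall k, lo <= beta k <= hi.

(* ell is the Lipschitz constant of the gradient, a the current alpha_k *)
Definition rho_of (ell alpha gamma mu a : R) : R :=
  ell / 2 + 3 * sigma A * gamma / (2 * (a - alpha) ^+ 2) + mu.

(* The values given to alpha_k by successive updates are the terms
   a 0, a 1, ... of a sequence satisfying P1 and P2; [j k] counts the updates
   made before step k.  An update happens exactly when the test holds, so
   alpha_k itself need not tend to alpha. *)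
Definition adaptive_update (alpha gamma eps : R) (z : nat -> 'cV[R]_s)
    (al : nat -> R) : Prop :=
  exists (a : nat -> R) (j : nat -> nat),
  [/\ P1 alpha gamma a, P2 alpha gamma a, a 0%N = alpha + gamma, j 0%N = 0%N &
    forall k, al k = a (j k) /\
      j k.+1 = if eps < (al k - alpha) * enorm (z k.+1) then (j k).+1 else j k].

Record adaptive_DPFS (ell alpha gamma mu eps : R)
    (al beta delta rho : nat -> R)
    (x : nat -> 'cV[R]_n) (y : nat -> 'cV[R]_p) (z : nat -> 'cV[R]_s) : Prop := {
  DPFS_x : forall k, proj_on S
    (x k + (rho k)^-1 *: (- gradient phi (x k) + K^T *m y k - A^T *m z k))
    (x k.+1);
  DPFS_y : forall k, prox (conjugate f) (beta k)^-1
    (y k + (beta k)^-1 *: (K *m x k.+1)) (y k.+1);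
  DPFS_z : forall k, prox (conjugate g) (al k)^-1
    (delta k *: z k + (al k)^-1 *: (A *m x k.+1)) (z k.+1);
  DPFS_alpha : adaptive_update alpha gamma eps z al;
  DPFS_beta : P3 beta;
  DPFS_delta : forall k, delta k = alpha / al k;
  DPFS_rho : forall k, rho k = rho_of ell alpha gamma mu (al k) }.

Definition stationary_from (ell alpha gamma mu eps : R)
    (al delta rho : nat -> R) (z : nat -> 'cV[R]_s) (K0 : nat) (talpha : R) :
    Prop :=
  alpha < talpha /\ forall k, (K0 <= k)%N ->
    [/\ al k = talpha, rho k = rho_of ell alpha gamma mu talpha,
        delta k = alpha / talpha & (al k - alpha) * enorm (z k.+1) <= eps].

(* Extended-real addition gives -oo + +oo = -oo; this only matters where
   g^*(z) = +oo, i.e. outside the region in which merit is considered. *)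
Definition merit (alpha talpha : R)
    (x : 'cV[R]_n) (y : 'cV[R]_p) (z u : 'cV[R]_s) : \bar R :=
  ((dot z (A *m x))%:E - conjugate g z + (phi x)%:E + indicator_of S x
   - (dot (K *m x) y)%:E + conjugate f y
   + (alpha / 2 * (1 + 4 * alpha / (talpha - alpha)) * enorm (z - u) ^+ 2)%:E
   - (2^-1 * (talpha - alpha) * enorm z ^+ 2)%:E)%E.

(* R^n x R^p x R^s x R^s is identified with R^(n + (p + (s + s))) through
   (x, y, z, u) |-> col_mx x (col_mx y (col_mx z u)). *)
Definition merit_vec (alpha talpha : R) (w : 'cV[R]_(n + (p + (s + s)))) :
    \bar R :=
  merit alpha talpha (usubmx w) (usubmx (dsubmx w))
    (usubmx (dsubmx (dsubmx w))) (dsubmx (dsubmx (dsubmx w))).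

Definition merit_region : set 'cV[R]_(n + (p + (s + s))) :=
  [set w | interior (edom (conjugate g)) (usubmx (dsubmx (dsubmx w)))].

End DPFS.

(* Main.v *)
Require Import Defs.
From HB Require Import structures.
From mathcomp Require Import all_boot all_order all_algebra.
From mathcomp Require Import all_classical all_reals all_analysis.
From mathcomp Require Import ring lra.
Set Implicit Arguments.
Unset Strict Implicit.
Unset Printing Implicit Defensive.
Import Order.TTheory GRing.Theory Num.Theory.
Import numFieldNormedType.Exports.
Local Open Scope classical_set_scope.
Local Open Scope ring_scope.

(** Every dual iterate [z k.+1] is a subgradient of [g] at a point [w] with
    [A x k.+1 + alpha z k - w = al k * z k.+1], and [A x k.+1 + alpha z k] stays in
    [K_r]; the Lipschitz bound on [K_r] therefore gives [|z k| <= lr] for all [k], so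
    the test [(al k - alpha) |z k.+1| > eps] succeeds only finitely often and the
    parameters become constant.

    From then on the merit function decreases by a multiple of the squared step: in
    the [z] block, where it is concave, one adds [4 alpha / (talpha - alpha)] times
    the monotonicity inequality of the subdifferential of the conjugate of [g].
    Essential strict convexity makes the subgradient [p] of the conjugate at [z k]
    unique, i.e. [p] is the unique minimiser of [g - <z k, .>]; a convex function with a
    unique minimiser grows linearly away from it, which yields both
    [z k] interior to the domain of the conjugate and Frechet differentiability there.
    Hence an explicit Frechet subgradient of the merit function is available at the
    iterates, bounded by a multiple of the last step.

    Compactness of [S], the bound on [z] and local boundedness of the subdifferential
    of [f] on [K(S)] give a cluster point, at which the optimality conditions hold by
    closedness of subdifferentials; the KL inequality traps the iterates near it.  The
    limit satisfies [A x - (talpha - alpha) z] in the subdifferential of the conjugate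
    of [g] at [z], with [(talpha - alpha) |z| <= eps], and the Lipschitz bound on
    [K_eps] turns this into an approximate KKT condition. *)

(** * Euclidean geometry of column vectors *)

Section EuclideanSpace.
Context {R : realType}.

Section OneSpace.
Context {m : nat}.
Implicit Types u v w : 'cV[R]_m.

Lemma dotC u v : dot u v = dot v u.
Proof. by apply: eq_bigr => i _; rewrite mulrC. Qed.

Lemma dotDl u v w : dot (u + v) w = dot u w + dot v w.
Proof. by rewrite -big_split; apply: eq_bigr => i _; rewrite mxE mulrDl. Qed.

Lemma dotDr u v w : dot w (u + v) = dot w u + dot w v.
Proof. by rewrite dotC dotDl !(dotC w). Qed.

Lemma dotZl a u v : dot (a *: u) v = a * dot u v.
Proof. by rewrite mulr_sumr; apply: eq_bigr => i _; rewrite mxE mulrA. Qed.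

Lemma dotZr a u v : dot u (a *: v) = a * dot u v.
Proof. by rewrite dotC dotZl dotC. Qed.

Lemma dotNl u v : dot (- u) v = - dot u v.
Proof. by rewrite -scaleN1r dotZl mulN1r. Qed.

Lemma dotNr u v : dot u (- v) = - dot u v.
Proof. by rewrite dotC dotNl dotC. Qed.

Lemma dot0l u : dot 0 u = 0.
Proof. by rewrite -(scale0r u) dotZl mul0r. Qed.

Lemma dot0r u : dot u 0 = 0.
Proof. by rewrite dotC dot0l. Qed.

Lemma dot_ge0 u : 0 <= dot u u.
Proof. by apply: sumr_ge0 => i _; rewrite -expr2 sqr_ge0. Qed.

Definition dotE := (dotDl, dotDr, dotNl, dotNr, dotZl, dotZr).

Lemma enorm_ge0 u : 0 <= enorm u.
Proof. exact: sqrtr_ge0. Qed.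

Lemma sqr_enorm u : enorm u ^+ 2 = dot u u.
Proof. exact/sqr_sqrtr/dot_ge0. Qed.

Lemma enorm_le u a : 0 <= a -> (enorm u <= a) = (dot u u <= a ^+ 2).
Proof. by move=> a0; rewrite -sqr_enorm ler_sqr // nnegrE ?enorm_ge0. Qed.

Lemma enorm0 : enorm (0 : 'cV[R]_m) = 0.
Proof. by rewrite /enorm dot0l sqrtr0. Qed.

Lemma enormZ a u : enorm (a *: u) = `|a| * enorm u.
Proof. by rewrite /enorm dotZl dotZr mulrA -expr2 sqrtrM ?sqr_ge0 // sqrtr_sqr. Qed.

Lemma enormN u : enorm (- u) = enorm u.
Proof. by rewrite -scaleN1r enormZ normrN1 mul1r. Qed.

Lemma enormB u v : enorm (u - v) = enorm (v - u).
Proof. by rewrite -enormN opprB. Qed.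

Lemma coord_le_enorm u i : `|u i 0| <= enorm u.
Proof.
rewrite -sqrtr_sqr ler_sqrt ?dot_ge0 // /dot (bigD1 i) //= expr2 lerDl.
by apply: sumr_ge0 => j _; rewrite -expr2 sqr_ge0.
Qed.

Lemma enorm_eq0 u : enorm u = 0 -> u = 0.
Proof.
move=> u0; apply/matrixP => i j; rewrite ord1 mxE; apply/eqP.
by rewrite -normr_eq0 eq_le normr_ge0 andbT -u0 coord_le_enorm.
Qed.

Lemma dot_le_enorm u v : dot u v <= enorm u * enorm v.
Proof.
have [u0|u0] := eqVneq (enorm u) 0; first by rewrite (enorm_eq0 u0) dot0l enorm0 mul0r.
have [v0|v0] := eqVneq (enorm v) 0; first by rewrite (enorm_eq0 v0) dot0r enorm0 mulr0.
have uv : 0 < enorm u * enorm v.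
  by rewrite mulr_gt0 // lt_def ?u0 ?v0 enorm_ge0.
have := dot_ge0 (enorm v *: u - enorm u *: v).
rewrite !dotE (dotC v u) -!sqr_enorm => h.
rewrite -(ler_pM2l uv); nra.
Qed.

Lemma dot_geN u v : - (enorm u * enorm v) <= dot u v.
Proof. by rewrite lerNl -dotNl -(enormN u) dot_le_enorm. Qed.

Lemma enormD u v : enorm (u + v) <= enorm u + enorm v.
Proof.
rewrite enorm_le ?addr_ge0 ?enorm_ge0 // !dotE (dotC v u) sqrrD !sqr_enorm.
have := dot_le_enorm u v; lra.
Qed.

Lemma enorm_triangle u v w : enorm (u - w) <= enorm (u - v) + enorm (v - w).
Proof. by apply: le_trans (enormD _ _); rewrite addrA subrK. Qed.

Lemma enorm_delta i : enorm (delta_mx i 0 : 'cV[R]_m) = 1.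
Proof.
rewrite /enorm /dot (bigD1 i) //= big1 ?addr0.
  by rewrite mxE !eqxx mul1r sqrtr1.
by move=> j ji; rewrite mxE (negbTE ji) mul0r.
Qed.

Lemma vec_sum_delta u : u = \sum_i u i 0 *: delta_mx i 0.
Proof. by rewrite [LHS]matrix_sum_delta; apply: eq_bigr => i _; rewrite big_ord1. Qed.

Lemma enorm_sum (I : Type) (r : seq I) (P : pred I) (F : I -> 'cV[R]_m) :
  enorm (\sum_(i <- r | P i) F i) <= \sum_(i <- r | P i) enorm (F i).
Proof.
elim/big_rec2 : _ => [|i a u _ h]; first by rewrite enorm0.
by apply: le_trans (enormD _ _) _; rewrite lerD2l.
Qed.

Lemma mx_norm_le_enorm u : `|u| <= enorm u.
Proof.
rewrite [leLHS]/Num.norm /= mx_normrE; apply/bigmax_leP; split; first exact: enorm_ge0.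
by move=> [i j] _ /=; rewrite ord1 coord_le_enorm.
Qed.

Lemma coord_le_mx_norm u i : `|u i 0| <= `|u|.
Proof.
rewrite [leRHS]/Num.norm /= mx_normrE.
by apply: (@le_bigmax _ _ _ _ (fun ij : 'I_m * 'I_1 => `|u ij.1 ij.2|) (i, 0)).
Qed.

Lemma enorm_le_mx_norm u : enorm u <= m%:R * `|u|.
Proof.
rewrite [in leLHS](vec_sum_delta u); apply: le_trans (enorm_sum _ _ _) _.
apply: (@le_trans _ _ (\sum_(i < m) `|u|)).
  by apply: ler_sum => i _; rewrite enormZ enorm_delta mulr1 coord_le_mx_norm.
by rewrite sumr_const card_ord mulr_natl.
Qed.

(** The bounds [|u| <= enorm u <= m%:R * |u|] make Euclidean balls a neighbourhood base of the
    sup-norm topology. *)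
Lemma nbhs_enormP u (P : set 'cV[R]_m) :
  nbhs u P <-> exists2 e : R, 0 < e & forall v, enorm (v - u) < e -> P v.
Proof.
split=> [/nbhs_normP[e /= e0 eP]|[e e0 eP]].
  exists e => // v vu; apply: eP => /=; apply: le_lt_trans vu.
  by rewrite distrC; exact: mx_norm_le_enorm.
(* The successor keeps the radius positive when [m = 0]. *)
apply/nbhs_ballP; exists (e / m.+1%:R) => /=; first by rewrite divr_gt0.
move=> v; rewrite -ball_normE /= => uv; apply: eP; apply: le_lt_trans (enorm_le_mx_norm _) _.
rewrite distrC ltr_pdivlMr // in uv; apply: le_lt_trans uv.
by rewrite mulrC ler_wpM2l // ler_nat.
Qed.

Lemma cvg_enormP (u_ : nat -> 'cV[R]_m) u :
  u_ @ \oo --> u <->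
  forall e : R, 0 < e -> exists N, forall k, (N <= k)%N -> enorm (u_ k - u) < e.
Proof.
split=> [cu e e0|cu P /nbhs_enormP[e e0 eP]].
  have /cu[N _ NP] : nbhs u [set v | enorm (v - u) < e].
    by apply/nbhs_enormP; exists e.
  by exists N => k Nk; apply: NP.
by have [N NP] := cu _ e0; exists N => // k Nk; apply/eP/NP.
Qed.

(** A bounded set lies in a product of segments, which is compact for row vectors; transposition
    carries this box to columns. *)
Lemma enorm_ball_compact (P : set 'cV[R]_m) (B : R) :
  closed P -> (forall v, P v -> enorm v <= B) -> compact P.
Proof.
move=> clP PB.
pose K := [set v : 'rV[R]_m | forall i, `[- B, B]%classic (v ord0 i)].
have cK : compact K.
  apply: (@rV_compact _ _ (fun=> `[- B, B]%classic)) => i; exact: segment_compact.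
apply: (@subclosed_compact _ _ ((fun v : 'rV[R]_m => v^T) @` K)) => //; last first.
  move=> v Pv; exists v^T; last by rewrite trmxK.
  move=> i; rewrite /= in_itv /= mxE -ler_norml.
  exact: le_trans (coord_le_enorm _ _) (PB _ Pv).
apply: continuous_compact cK; apply: continuous_subspaceT => v Q /=.
move=> /nbhs_ballP[e /= e0 eQ]; apply/nbhs_ballP; exists e => //= w vw.
apply: eQ; case: vw => _ vw; split=> // i j; rewrite !mxE; exact: vw.
Qed.

Lemma enorm_continuous_at w u : forall e : R, 0 < e ->
  forall v, enorm (v - u) < e -> `|enorm (v - w) - enorm (u - w)| < e.
Proof.
move=> e e0 v vu; have := enorm_triangle v u w; have := enorm_triangle u v w.
rewrite (enormB u v) ltr_norml; lra.
Qed.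

Lemma closed_enorm_sphere w (r : R) : closed [set v | enorm (v - w) = r].
Proof.
move=> u; rewrite closureEcvg /= => -[F FF [Fu SF]].
apply/eqP; apply/negPn/negP => ne.
have d0 : 0 < `|enorm (u - w) - r| by rewrite normr_gt0 subr_eq0.
have : F [set v | enorm (v - u) < `|enorm (u - w) - r|].
  by apply: Fu; apply/nbhs_enormP; exists `|enorm (u - w) - r|.
move=> Fd.
have : F [set v | enorm (v - w) = r] by exact: SF.
move=> Fr; have [v [vu vr]] := filter_ex (filterI Fd Fr).
have := enorm_continuous_at w d0 vu; rewrite /= vr distrC ltxx //.
Qed.

Lemma closed_enorm_ball w (r : R) : closed [set v | enorm (v - w) <= r].
Proof.
move=> u clu /=; rewrite leNgt; apply/negP => ru.
have d0 : 0 < enorm (u - w) - r by rewrite subr_gt0.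
have [|v [vr vu]] := clu [set v | enorm (v - u) < enorm (u - w) - r].
  by apply/nbhs_enormP; exists (enorm (u - w) - r).
have := enorm_triangle u v w; rewrite (enormB u v).
move: vr vu => /=; lra.
Qed.

End OneSpace.

Lemma dot_col_mx m1 m2 (u1 v1 : 'cV[R]_m1) (u2 v2 : 'cV[R]_m2) :
  dot (col_mx u1 u2) (col_mx v1 v2) = dot u1 v1 + dot u2 v2.
Proof.
rewrite /dot big_split_ord /=; congr (_ + _); apply: eq_bigr => i _.
  by rewrite !col_mxEu.
by rewrite !col_mxEd.
Qed.

Lemma enorm_col_mx m1 m2 (u : 'cV[R]_m1) (v : 'cV[R]_m2) :
  enorm (col_mx u v) <= enorm u + enorm v.
Proof.
rewrite enorm_le ?addr_ge0 ?enorm_ge0 // dot_col_mx sqrrD !sqr_enorm.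
have := mulr_ge0 (enorm_ge0 u) (enorm_ge0 v); lra.
Qed.

Lemma enorm_usubmx m1 m2 (u : 'cV[R]_(m1 + m2)) : enorm (usubmx u) <= enorm u.
Proof.
rewrite -[in leRHS](vsubmxK u) enorm_le ?enorm_ge0 // sqr_enorm dot_col_mx.
by rewrite lerDl dot_ge0.
Qed.

Lemma enorm_dsubmx m1 m2 (u : 'cV[R]_(m1 + m2)) : enorm (dsubmx u) <= enorm u.
Proof.
rewrite -[in leRHS](vsubmxK u) enorm_le ?enorm_ge0 // sqr_enorm dot_col_mx.
by rewrite lerDr dot_ge0.
Qed.

Lemma dot_trmx a b (M : 'M[R]_(a, b)) u v : dot (M^T *m u) v = dot u (M *m v).
Proof.
have dE c (w w' : 'cV[R]_c) : dot w w' = (w^T *m w') 0 0.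
  by rewrite mxE; apply: eq_bigr => i _; rewrite mxE.
by rewrite !dE trmx_mul trmxK mulmxA.
Qed.

(** This crude bound shows that the supremum defining [opnorm] is taken over a bounded set. *)
Lemma enorm_mulmx_bound a b (M : 'M[R]_(a, b)) :
  exists2 C, 0 <= C & forall v, enorm (M *m v) <= C * enorm v.
Proof.
exists (\sum_j enorm (M *m delta_mx j 0 : 'cV_a)).
  by apply: sumr_ge0 => j _; exact: enorm_ge0.
move=> v; rewrite [in leLHS](vec_sum_delta v) mulmx_sumr.
apply: le_trans (enorm_sum _ _ _) _; rewrite mulr_suml; apply: ler_sum => j _.
by rewrite -scalemxAr enormZ mulrC ler_wpM2l ?enorm_ge0 ?coord_le_enorm.
Qed.

Lemma opnorm_ub a b (M : 'M[R]_(a, b)) v :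
  enorm v <= 1 -> enorm (M *m v) <= opnorm M.
Proof.
move=> v1; have [C C0 MC] := enorm_mulmx_bound M.
apply: ub_le_sup; last by exists v.
exists C => _ [x /= x1 <-]; apply: le_trans (MC x) _.
by rewrite -[leRHS]mulr1 ler_wpM2l.
Qed.

Lemma opnorm_ge0 a b (M : 'M[R]_(a, b)) : 0 <= opnorm M.
Proof.
by apply: le_trans (@opnorm_ub _ _ M 0 _); rewrite ?enorm_ge0 ?enorm0.
Qed.

Lemma enorm_mulmx a b (M : 'M[R]_(a, b)) v :
  enorm (M *m v) <= opnorm M * enorm v.
Proof.
have [v0|v0] := eqVneq (enorm v) 0.
  by rewrite v0 mulr0 (enorm_eq0 v0) mulmx0 enorm0.
have vp : 0 < enorm v by rewrite lt_def v0 enorm_ge0.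
have vE : v = enorm v *: ((enorm v)^-1 *: v).
  by rewrite scalerA divff // scale1r.
rewrite {1}vE -scalemxAr enormZ gtr0_norm // mulrC ler_pM2r //.
by apply: opnorm_ub; rewrite enormZ gtr0_norm ?invr_gt0 // mulVf.
Qed.

Lemma sqr_enorm_mulmx a b (M : 'M[R]_(a, b)) v :
  enorm (M *m v) ^+ 2 <= sigma M * enorm v ^+ 2.
Proof.
rewrite /sigma -exprMn ler_sqr ?nnegrE ?enorm_ge0 ?mulr_ge0 ?opnorm_ge0 ?enorm_ge0 //.
exact: enorm_mulmx.
Qed.

End EuclideanSpace.

(** * Convex analysis *)

(** Products [M *m v] are abstracted first, since [mxE] would otherwise unfold them into sums. *)
Ltac vector_ring :=
  repeat match goal with |- context [?M *m ?v] => move: (M *m v) => ? end;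
  apply/matrixP => ? ?; rewrite !mxE; ring.

(** * Lower semicontinuous functions on compact sets *)

Section Semicontinuity.
Context {R : realType} {m : nat}.
Implicit Types (h : 'cV[R]_m -> \bar R) (C : set 'cV[R]_m).

Lemma lte_fin_gap (a : R) (x : \bar R) :
  (a%:E < x)%E -> exists2 e : R, 0 < e & ((a + e)%:E < x)%E.
Proof.
case: x => [b|_|]; rewrite ?lte_fin //.
- by move=> ab; exists ((b - a) / 2); rewrite ?lte_fin; lra.
- by exists 1 => //; rewrite ltry.
Qed.

Lemma lsc_compact_gap h C (a : R) : compact C -> lower_semicontinuous h ->
  (forall x, C x -> (a%:E < h x)%E) ->
  exists2 e : R, 0 < e & forall x, C x -> ((a + e)%:E < h x)%E.
Proof.
move=> /compact_near_coveringP cC lh ah.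
have : \forall e \near (0 : R)^'+, C `<=` (fun x => ((a + e)%:E < h x)%E).
  apply: cC => x Cx.
  have [e e0 aeh] := lte_fin_gap (ah x Cx).
  have [V Vx Vh] := lh x _ aeh.
  exists (V, [set d | d < e]); first by split=> //=; exact: nbhs_right_lt.
  move=> [y d] /= [Vy de]; apply: lt_trans (Vh y Vy).
  by rewrite lte_fin ltrD2l.
move=> /(filterI (nbhs_right_gt (0 : R))) /filter_ex[e [e0 Ce]].
by exists e.
Qed.

(** Were the infimum not attained, [h] would exceed it strictly on [C], and the uniform gap would
    produce a larger lower bound. *)
Lemma lsc_compact_argmin h C (b : R) x0 : compact C -> lower_semicontinuous h ->
  (forall x, C x -> (b%:E <= h x)%E) -> C x0 -> (h x0 < +oo)%E ->
  argmin C h !=set0.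
Proof.
move=> cC lh bh Cx0 hx0; pose M := ereal_inf (h @` C).
have lbM x : C x -> (M <= h x)%E by move=> Cx; apply: ereal_inf_lbound; exists x.
have bM : (b%:E <= M)%E by apply/ereal_infP => _ [x Cx <-]; exact: bh.
have Mfin : M = (fine M)%:E.
  apply/esym/fineK; rewrite fin_numE; apply/andP; split.
    by apply/eqP => M0; rewrite M0 in bM.
  by apply/eqP => M0; have := le_lt_trans (lbM _ Cx0) hx0; rewrite M0.
apply/not_existsP => noarg.
have [x Cx|e e0 eh] := @lsc_compact_gap h C (fine M) cC lh.
  rewrite -Mfin lt_neqAle lbM // andbT; apply/eqP => Mx.
  by apply: (noarg x); split=> // y Cy; rewrite -Mx lbM.
have : ((fine M + e)%:E <= M)%E.
  by apply/ereal_infP => _ [x Cx <-]; exact/ltW/eh.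
by rewrite Mfin lee_fin gerDl leNgt e0.
Qed.

Lemma lsc_addr h (k : 'cV[R]_m -> R) : lower_semicontinuous h ->
  (forall x (e : R), 0 < e -> nbhs x [set y | k x - e < k y]) ->
  lower_semicontinuous (fun x => h x + (k x)%:E)%E.
Proof.
move=> lh lk x a ax.
have : ((a - k x)%:E < h x)%E.
  by move: ax; case: (h x) => [b| |] //; rewrite ?ltry // -EFinD !lte_fin; lra.
move=> /lte_fin_gap[e e0 eh]; have [V Vx Vh] := lh _ _ eh.
exists (V `&` [set y | k x - e < k y]); first by apply: filterI => //; exact: lk.
move=> y [/Vh + /=]; case: (h y) => [b| |] //; rewrite ?ltry // -?EFinD !lte_fin; lra.
Qed.

End Semicontinuity.

(** The form in which first-order optimality is extracted below: [l * Y] is the quadratic remainder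
    of a perturbation of size [l], already divided by [l]. *)
Lemma le0_of_small {R : realType} (X Y : R) :
  (forall l : R, 0 < l < 1 -> X <= l * Y) -> X <= 0.
Proof.
move=> XY; rewrite leNgt; apply/negP => X0.
have Y0 : 0 < Y by have := XY (1 / 2); lra.
(* For this [l] the product [l * Y] is less than [X / 2]. *)
have := XY (X / (2 * (X + Y))).
have d0 : 0 < X + Y by rewrite addr_gt0.
have -> : X / (2 * (X + Y)) * Y = X * (Y / (2 * (X + Y))) by field; lra.
have q : Y / (2 * (X + Y)) < 1 by rewrite ltr_pdivrMr; lra.
have q1 : X / (2 * (X + Y)) < 1 by rewrite ltr_pdivrMr; lra.
have q2 : 0 < X / (2 * (X + Y)) by rewrite divr_gt0 //; lra.
rewrite q1 q2 => /(_ isT); nra.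
Qed.

(** * Subgradients, conjugates and proximal points *)

Section Subgradients.
Context {R : realType} {m : nat}.
Implicit Types (h : 'cV[R]_m -> \bar R) (C : set 'cV[R]_m).

Lemma subdiffP h x v : subdiff h x v <->
  exists2 a, h x = a%:E & forall y, ((a + dot v (y - x))%:E <= h y)%E.
Proof.
split=> [[hx hv]|[a hx hv]].
  exists (fine (h x)); first by rewrite fineK.
  by move=> y; have := hv y; rewrite -[in X in X -> _](fineK hx) sube0.
by split=> [|y]; rewrite hx // sube0; exact: hv.
Qed.

Lemma subdiff_monotone h x y u v : subdiff h x u -> subdiff h y v ->
  0 <= dot (u - v) (x - y).
Proof.
move=> /subdiffP[a hx hu] /subdiffP[b hy hv].
have := hu y; have := hv x; rewrite hx hy !lee_fin !dotE; lra.
Qed.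

Lemma conjugate_ge h x y : ((dot y x)%:E - h x <= conjugate h y)%E.
Proof. by apply: ereal_sup_ubound; exists x. Qed.

Lemma conjugate_le h y b :
  (forall x, ((dot y x)%:E - h x <= b)%E) -> (conjugate h y <= b)%E.
Proof. by move=> hb; apply/ereal_supP => _ [x _ <-]. Qed.

Lemma conjugate_gtNy h : eproper h -> forall y, (-oo < conjugate h y)%E.
Proof.
move=> [hN [x hx]] y; apply: lt_le_trans (conjugate_ge h x y).
by move: hx (hN x); case: (h x) => [a| |] _ _ //; rewrite ?ltNyr.
Qed.

(** The equality case of Fenchel-Young: the subgradient inequality says exactly that [q] attains the
    supremum defining the conjugate. *)
Lemma conjugate_subdiff h q y a : h q = a%:E -> subdiff h q y ->
  conjugate h y = (dot y q - a)%:E.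
Proof.
move=> hq /subdiffP[b]; rewrite hq => -[<-] hy.
apply/eqP; rewrite eq_le; apply/andP; split; last first.
  by have := conjugate_ge h q y; rewrite hq.
apply: conjugate_le => x; have := hy x.
case: (h x) => [c| |] //; last by rewrite leNye.
by rewrite -EFinD !lee_fin !dotE; lra.
Qed.

Lemma subdiff_conjugate h q y : subdiff h q y -> subdiff (conjugate h) y q.
Proof.
move=> hqy; have /subdiffP[a hq _] := hqy.
apply/subdiffP; exists (dot y q - a); first exact: conjugate_subdiff.
move=> y'; apply: le_trans (conjugate_ge h q y'); rewrite hq -EFinD lee_fin.
by rewrite !dotE (dotC q y) (dotC q y'); lra.
Qed.

Lemma econvex_conjugate h : eproper h -> econvex (conjugate h).
Proof.
move=> ph x y t /andP[t0 t1]; apply: conjugate_le => v.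
have := conjugate_ge h v x; have := conjugate_ge h v y.
have := conjugate_gtNy ph x; have := conjugate_gtNy ph y; have := ph.1 v.
case: (h v) => [c| |] // _; last by rewrite !leNye.
have tt : 0 < 1 - t by lra.
case: (conjugate h x) => [a| |] // _; case: (conjugate h y) => [b| |] // _;
  rewrite -?EFinM -?EFinD ?lee_fin ?gt0_muley ?lte_fin ?leey //.
by rewrite !dotE => h1 h2; nra.
Qed.

(** The minimiser [y] is compared with [l *: v + (1 - l) *: y]; convexity leaves a first-order
    inequality with a remainder of order [l], removed by [le0_of_small]. *)
Lemma prox_subdiff h (t : R) w y : econvex h -> eproper h -> 0 < t ->
  prox h t w y -> subdiff h y (t^-1 *: (w - y)).
Proof.
move=> ch [hN [x hx]] t0 [_ min_y].
have [a hy] : exists a, h y = a%:E.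
  have := min_y x I; move: hx (hN x) (hN y).
  by case: (h x) (h y) => [b| |] // [a| |] //; exists a.
apply/subdiffP; exists a => // v; have := hN v.
case hv : (h v) => [b| |] // _; last by rewrite leey.
rewrite lee_fin -subr_le0; apply: (@le0_of_small _ _ ((2 * t)^-1 * enorm (v - y) ^+ 2)).
move=> l l01; have := ch v y l l01; have := min_y (l *: v + (1 - l) *: y) I.
have /andP[l0 l1] := l01.
rewrite hy hv -EFinM -!EFinD.
have := hN (l *: v + (1 - l) *: y).
case: (h _) => [c| |] // _; rewrite !lee_fin.
have -> : l *: v + (1 - l) *: y - w = (y - w) + l *: (v - y).
  by vector_ring.
rewrite !sqr_enorm !dotE (dotC v y) (dotC w y) (dotC v w).
rewrite invfM.
have : 0 < t^-1 by rewrite invr_gt0.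
move: (t^-1) => k k0 h1 h2; rewrite -(ler_pM2l l0); nra.
Qed.

End Subgradients.

(* [lra] fails when the context contains facts about extended reals. *)
Ltac clear_ereal := repeat match goal with
  | H : is_true (@Order.le _ _ ?x _) |- _ =>
      let T := type of x in unify T (\bar _); clear H
  | H : is_true (@Order.lt _ _ ?x _) |- _ =>
      let T := type of x in unify T (\bar _); clear H
  | H : @eq (\bar _) _ _ |- _ => clear H
  end.
Ltac rlra := clear_ereal; lra.
Ltac rnra := clear_ereal; nra.

(** * Bounds on convex functions and existence of proximal points *)

Section ConvexFunctions.
Context {R : realType} {m : nat}.
Implicit Types (h : 'cV[R]_m -> \bar R) (C : set 'cV[R]_m).

(* Apply convexity at [a], between [w] and the antipodal point at distance [r]. *)
Lemma econvex_conic_minorant h a (fa M r : R) : econvex h ->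
  (forall x, -oo < h x)%E -> h a = fa%:E -> 0 < r ->
  (forall v, enorm (v - a) <= r -> (h v <= M%:E)%E) ->
  forall w, ((fa - (M - fa) / r * enorm (w - a))%:E <= h w)%E.
Proof.
move=> ch hN ha r0 hM w; have := hN w; case hw : (h w) => [b| |] // _; last first.
  by rewrite leey.
rewrite lee_fin.
have [D0|D0] := eqVneq (enorm (w - a)) 0.
  have wa : w = a by apply/eqP; rewrite -subr_eq0 (enorm_eq0 D0).
  by move: hw; rewrite wa ha => -[->]; rewrite subrr enorm0 mulr0 subr0.
have {}D0 : 0 < enorm (w - a) by rewrite lt_def D0 enorm_ge0.
move: D0; set D := enorm (w - a) => D0.
pose l := r / (r + D); pose u := a - (r / D) *: (w - a).
have rD : 0 < r + D by rlra.
have l01 : 0 < l < 1 by rewrite divr_gt0 //= ltr_pdivrMr // mul1r; rlra.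
have hu : (h u <= M%:E)%E.
  apply: hM; rewrite /u addrC addKr enormN enormZ -/D gtr0_norm ?divr_gt0 //.
  by rewrite divfK ?gt_eqF.
have := ch w u l l01; have -> : l *: w + (1 - l) *: u = a.
  have -> : 1 - l = D / (r + D) by rewrite /l; field; rlra.
  rewrite /u /l; apply/matrixP => i j; rewrite !mxE; field; rlra.
have := hN u; move: hu; case: (h u) => [c| |] // hu _.
rewrite ha hw -!EFinM -EFinD !lee_fin => h1; rewrite lee_fin in hu.
have h2 : fa <= l * b + (1 - l) * M.
  by apply: le_trans h1 _; rewrite lerD2l ler_pM2l //; rlra.
have h3 : fa * (r + D) <= r * b + D * M.
  have -> : r * b + D * M = (l * b + (1 - l) * M) * (r + D) by rewrite /l; field; rlra.
  by rewrite ler_pM2r.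
have -> : fa - (M - fa) / r * D = (fa * (r + D) - D * M) / r by field; rlra.
by rewrite ler_pdivrMr //; rlra.
Qed.

Lemma econvex_le_max h x y (t M : R) : econvex h -> (forall v, -oo < h v)%E ->
  0 <= t <= 1 -> (h x <= M%:E)%E -> (h y <= M%:E)%E ->
  (h (t *: x + (1 - t)%R *: y)%R <= M%:E)%E.
Proof.
move=> ch hN /andP[t0 t1] hx hy.
have [->|tn0] := eqVneq t 0; first by rewrite scale0r add0r subr0 scale1r.
have [->|tn1] := eqVneq t 1; first by rewrite subrr scale0r addr0 scale1r.
have t01 : 0 < t < 1 by rewrite !lt_def tn0 t0 eq_sym tn1 t1.
apply: le_trans (ch x y t t01) _.
have := hN x; have := hN y; move: hx hy.
case: (h x) => [a| |] //; case: (h y) => [b| |] //.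
rewrite -!EFinM -EFinD !lee_fin; rnra.
Qed.

(** Coordinate directions are added one at a time: each new point is the midpoint of a point moved
    along the new direction and one moved along the earlier directions, both by twice the final
    displacement. *)
Lemma econvex_locally_bounded h a : econvex h -> (forall x, -oo < h x)%E ->
  interior (edom h) a ->
  exists r M : R, 0 < r /\ forall v, enorm (v - a) <= r -> (h v <= M%:E)%E.
Proof.
move=> ch hN /nbhs_enormP[e e0 he].
have bd (s : seq 'I_m) : exists r M : R, 0 < r /\
    forall c : 'I_m -> R, (forall i, `|c i| <= r) ->
    (h (a + \sum_(i <- s) c i *: delta_mx i 0)%R <= M%:E)%E.
  elim: s => [|i s [r [M [r0 IH]]]].
    exists 1, (fine (h a)); split=> // c _; rewrite big_nil addr0 fineK //.
    have ha : (h a < +oo)%E by apply: he; rewrite subrr enorm0.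
    by rewrite fin_numE (gt_eqF (hN a)) (lt_eqF ha).
  pose d := e / 2; have d0 : 0 < d by rewrite /d; rlra.
  pose p := a + d *: delta_mx i 0; pose q := a - d *: delta_mx i 0.
  have fp : (h p < +oo)%E.
    by apply: he; rewrite addrC addKr enormZ enorm_delta gtr0_norm /d //; rlra.
  have fq : (h q < +oo)%E.
    by apply: he; rewrite addrC addKr enormN enormZ enorm_delta gtr0_norm /d //; rlra.
  pose N := Num.max M (Num.max (fine (h p)) (fine (h q))).
  have hp : (h p <= N%:E)%E.
    move: (hN p) fp; rewrite /N; case: (h p) => [b| |] //= _ _.
    by rewrite lee_fin !le_max lexx !orbT.
  have hq : (h q <= N%:E)%E.
    move: (hN q) fq; rewrite /N; case: (h q) => [b| |] //= _ _.
    by rewrite lee_fin !le_max lexx !orbT.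
  have MN : (M%:E <= N%:E)%E by rewrite lee_fin le_max lexx.
  exists (Num.min (r / 2) (d / 2)), N; split.
    by rewrite lt_min !divr_gt0.
  move=> c hc; rewrite big_cons.
  (* [t] places [a + (2 * c i) *: delta_mx i 0] on the segment from [q] to [p]. *)
  pose t := (1 + 2 * c i / d) / 2.
  have := hc i; rewrite le_min => /andP[_]; rewrite ler_norml => /andP[c1 c2].
  have ct : c i = d * (t - 1 / 2) by rewrite /t; field; rlra.
  have t01 : 0 <= t <= 1.
    rewrite -(ler_pM2l d0) -(ler_pM2l d0 t); rlra.
  have h1 := econvex_le_max ch hN t01 hp hq.
  have h2 : (h (a + \sum_(j <- s) (2 * c j) *: delta_mx j 0)%R <= N%:E)%E.
    apply: le_trans MN; apply: IH => j; rewrite normrM ger0_norm //.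
    by have := hc j; rewrite le_min => /andP[]; rlra.
  have half01 : 0 <= (1 / 2 : R) <= 1 by apply/andP; split; rlra.
  have := econvex_le_max ch hN half01 h1 h2; congr (h _ <= _)%E.
  under [X in a + X]eq_bigr do rewrite -scalerA.
  rewrite -scaler_sumr; move: (\sum_(_ <- _) _) => S.
  rewrite /p /q ct; by apply/matrixP => k j; rewrite !mxE; field.
have [r [M [r0 hr]]] := bd (index_enum 'I_m).
exists r, M; split=> // v va; rewrite -(subrK a v) addrC (vec_sum_delta (v - a)).
by apply: hr => i; exact: le_trans (coord_le_enorm _ _) va.
Qed.

(** The conic minorant decays at most linearly, so the quadratic term dominates and the minimisation
    can be confined to a closed ball. *)
Lemma prox_nonempty h b : proper_convex_lsc h -> interior (edom h) !=set0 ->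
  prox h 1 b !=set0.
Proof.
move=> [[hN _] ch lh] [a ha].
have [r [M [r0 hM]]] := econvex_locally_bounded ch hN ha.
have [fa haE] : exists fa, h a = fa%:E.
  have : (h a <= M%:E)%E by apply: hM; rewrite subrr enorm0 ltW.
  by move: (hN a); case: (h a) => [fa| |] //; exists fa.
have mino := econvex_conic_minorant ch hN haE r0 hM.
have M0 : fa <= M.
  by rewrite -lee_fin -haE hM // subrr enorm0 ltW.
move: mino; set L := (M - fa) / r => mino.
have L0 : 0 <= L by apply: divr_ge0; [rewrite subr_ge0|exact: ltW].
pose q w := (2 * 1)^-1 * enorm (w - b) ^+ 2 : R.
pose F w := (h w + (q w)%:E)%E.
pose D := enorm (b - a).
have D0 : 0 <= D by exact: enorm_ge0.
have qE w : q w = 1 / 2 * enorm (w - b) ^+ 2 by rewrite /q mulr1 div1r.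
have Flow w : ((fa - L * D - L * enorm (w - b) + 1 / 2 * enorm (w - b) ^+ 2)%:E <= F w)%E.
  rewrite /F qE; have := mino w; have := enorm_triangle w b a; rewrite -/D.
  move: (hN w); case: (h w) => [c| |] //= _ t; last by rewrite addye ?leey.
  by rewrite -EFinD !lee_fin; rnra.
have Fa : F a = (fa + q a)%:E by rewrite /F haE.
pose K : R := `|fa + q a - (fa - L * D)|; have K0 : 0 <= K by exact: normr_ge0.
have KE : fa + q a - (fa - L * D) <= K by exact: ler_norm.
(* Outside radius [B] the lower bound [Flow] is at least [F a], and [D <= B] puts [a] inside the
   ball. *)
pose B := 2 * L + 2 + 2 * K + D.
have Bcomp : compact [set w | enorm (w - b) <= B].
  apply: (@enorm_ball_compact _ _ _ (B + enorm b)); first exact: closed_enorm_ball.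
  move=> w /= wb; have := enorm_triangle w b 0; rewrite !subr0; rlra.
have [|w _|||w [wB wmin]] := @lsc_compact_argmin _ _ F _ (fa - L * D - L ^+ 2) a Bcomp.
- apply: lsc_addr => // w e e0; apply/nbhs_enormP.
  pose d := Num.min 1 (e / (enorm (w - b) + 1)).
  have wb0 := enorm_ge0 (w - b).
  have d0 : 0 < d by rewrite lt_min ltr01 divr_gt0 //; rlra.
  have d1 : d <= 1 by rewrite ge_min lexx.
  have de : d * (enorm (w - b) + 1) <= e.
    by rewrite -ler_pdivlMr ?ge_min ?lexx ?orbT //; rlra.
  exists d => // v vw; rewrite /= !qE.
  have := enorm_triangle w v b; rewrite (enormB w v).
  move: vw (enorm_ge0 (v - b)) (enorm_ge0 (v - w)).
  move: (enorm (v - w)) (enorm (v - b)) wb0 de => t y; move: (enorm (w - b)) => x.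
  move=> x0 de td y0 t0 xty; have [xy|yx] := leP x y.
    by have : x * x <= y * y; [exact: ler_pM|rlra].
  have : (x - y) * (x + y) <= t * (2 * x) by apply: ler_pM; rlra.
  have : t * x <= d * x by rewrite ler_wpM2r // ltW.
  rlra.
- apply: le_trans (Flow w); rewrite lee_fin.
  have := sqr_ge0 (enorm (w - b) - L); rnra.
- by rewrite /= enormB -/D /B; rlra.
- by rewrite Fa ltry.
exists w; split=> // v _; rewrite -/(q w) -/(q v).
have [vB|vB] := leP (enorm (v - b)) B; first exact: wmin.
have aB : enorm (a - b) <= B by rewrite enormB -/D /B; rlra.
apply: le_trans (wmin a aB) _; apply: le_trans (Flow v); rewrite Fa lee_fin.
have BE : B = 2 * L + 2 + 2 * K + D by [].
have h1 : B * (B - 2 * L) <= enorm (v - b) * (enorm (v - b) - 2 * L).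
  by apply: ler_pM; rlra.
have h2 : B * 1 <= B * (B - 2 * L) by rewrite ler_pM2l; rlra.
rlra.
Qed.

End ConvexFunctions.

(** * Duality between a function and its conjugate *)

Section Duality.
Context {R : realType} {m : nat}.
Implicit Types (h : 'cV[R]_m -> \bar R) (C : set 'cV[R]_m).

Lemma convex_setP C : convex_set C <->
  forall v w (t : R), C v -> C w -> 0 < t < 1 -> C (t *: v + (1 - t) *: w).
Proof.
split=> [/convex_setW cC v w t Cv Cw /andP[t0 t1]|cC].
  have := cC v w (mem_set Cv) (mem_set Cw) (Itv01 (ltW t0) (ltW t1)) t0 t1.
  exact: set_mem.
apply/convex_setW => v w; rewrite !inE => Cv Cw k k0 k1.
by apply/mem_set/cC => //; rewrite k0.
Qed.

(** Minty's surjectivity: the identity plus the subdifferential takes every value [b]. *)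
Lemma prox_subdiff_exists h b : proper_convex_lsc h -> interior (edom h) !=set0 ->
  exists w, subdiff h w (b - w).
Proof.
move=> ph hi; have [w wb] := prox_nonempty b ph hi; exists w.
have [pr ch _] := ph.
by have := prox_subdiff ch pr ltr01 wb; rewrite invr1 scale1r.
Qed.

Lemma eproper_conjugate h : proper_convex_lsc h -> interior (edom h) !=set0 ->
  eproper (conjugate h).
Proof.
move=> ph hi; split; first by apply: conjugate_gtNy; case: ph.
have [w hw] := prox_subdiff_exists 0 ph hi; exists (0 - w).
by have /subdiffP[a -> _] := subdiff_conjugate hw; rewrite ltry.
Qed.

(* With [w] the proximal point of [q + y], both [(q, y)] and [(w, q + y - w)]
   lie on the graph of the inverse subdifferential, and monotonicity forces
   [q = w]; this avoids the Fenchel-Moreau theorem. *)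
Lemma subdiff_of_conjugate h q y : proper_convex_lsc h ->
  interior (edom h) !=set0 -> subdiff (conjugate h) y q -> subdiff h q y.
Proof.
move=> ph hi hyq; have [w hw] := prox_subdiff_exists (q + y) ph hi.
have := subdiff_monotone hyq (subdiff_conjugate hw).
have -> : y - (q + y - w) = - (q - w) by vector_ring.
rewrite dotNr oppr_ge0 -sqr_enorm => qw.
have /enorm_eq0/eqP : enorm (q - w) = 0.
  by apply/eqP; rewrite -sqrf_eq0 eq_le qw sqr_ge0.
rewrite subr_eq0 => /eqP qw0; move: hw; rewrite -qw0.
by have -> : q + y - q = y by vector_ring.
Qed.

Lemma subdiff_conjugateE h q y : proper_convex_lsc h ->
  interior (edom h) !=set0 -> subdiff (conjugate h) y q <-> subdiff h q y.
Proof.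
by move=> ph hi; split; [exact: subdiff_of_conjugate|exact: subdiff_conjugate].
Qed.

(** The points having [z] as a subgradient form a convex set on which [h] is affine; strict
    convexity on that set leaves it at most one point. *)
Lemma subdiff_conjugate_unique h z p q : proper_convex_lsc h ->
  interior (edom h) !=set0 -> essentially_strictly_convex h ->
  subdiff (conjugate h) z p -> subdiff (conjugate h) z q -> p = q.
Proof.
move=> ph hi hs; rewrite !(subdiff_conjugateE _ _ ph hi) => hp hq.
apply/eqP/negPn/negP => pq.
have [[hN _] ch _] := ph.
have /subdiffP[a hpa hpz] := hp; have /subdiffP[b hqb hqz] := hq.
pose P v := subdiff h v z.
have ab : b = a + dot z (q - p).
  have := hpz q; have := hqz p; rewrite hpa hqb !lee_fin !dotE => h1 h2; rlra.
have Pc v w (t : R) : P v -> P w -> 0 < t < 1 -> P (t *: v + (1 - t) *: w).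
  move=> /subdiffP[c hv hvz] /subdiffP[d hw hwz] t01.
  have /andP[t0 t1] := t01.
  have dE : d = c + dot z (w - v).
    by have := hvz w; have := hwz v; rewrite hv hw !lee_fin !dotE => h1 h2; rlra.
  have := ch v w t t01; have := hvz (t *: v + (1 - t) *: w); rewrite hv hw.
  rewrite -!EFinM -EFinD.
  case hu : (h _) => [e| |] //; rewrite !lee_fin => h1 h2.
  apply/subdiffP; exists e => // y; apply: le_trans (hvz y); rewrite lee_fin.
  by move: h1 h2; rewrite dE !dotE => h1 h2; rlra.
have := hs [set v | P v] _ _ _ p q (1 / 2) hp hq pq.
have t01 : 0 < (1 / 2 : R) < 1 by apply/andP; split; rlra.
have /subdiffP[c hu huz] := Pc p q _ hp hq t01.
have h0 : c = 1 / 2 * a + (1 - 1 / 2) * b.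
  have := huz p; have := hpz (1 / 2 *: p + (1 - 1 / 2) *: q).
  by rewrite hu hpa !lee_fin ab !dotE => h1 h2; rlra.
move=> /(_ _ _ _ t01); rewrite hu hpa hqb -!EFinM -EFinD lte_fin h0 ltxx => K.
have K1 : [set v | P v] !=set0 by exists p.
have K2 : convex_set [set v | P v] by apply/convex_setP => v w t; exact: Pc.
have K3 : [set v | P v] `<=` [set x | subdiff h x !=set0] by move=> v Pv; exists z.
by have := K K1 K2 K3.
Qed.

(** The upper half of Frechet differentiability, the subgradient inequality being the lower half. By
    uniqueness [p] is the only minimiser of [G], and compactness of a sphere around [p] turns this
    into a positive gap. *)
Lemma conjugate_differentiable h z p (c e : R) : proper_convex_lsc h ->
  interior (edom h) !=set0 -> essentially_strictly_convex h ->
  subdiff (conjugate h) z p -> conjugate h z = c%:E -> 0 < e ->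
  exists2 d : R, 0 < d & forall z', enorm (z' - z) < d ->
  (conjugate h z' <= (c + dot p (z' - z) + e * enorm (z' - z))%:E)%E.
Proof.
move=> ph hi hs hzp hzc e0; have [[hN _] ch lh] := ph.
have hpz : subdiff h p z by exact/subdiff_conjugateE.
have /subdiffP[a hpa hpz'] := hpz.
have cE : c = dot z p - a.
  by have := conjugate_subdiff hpa hpz; rewrite hzc => -[].
pose G v := (h v + (dot (- z) v)%:E)%E.
pose Sph := [set v : 'cV[R]_m | enorm (v - p) = e].
have cS : compact Sph.
  apply: (@enorm_ball_compact _ _ _ (e + enorm p)); first exact: closed_enorm_sphere.
  move=> v; rewrite /Sph /= => vp; have := enorm_triangle v p 0; rewrite !subr0; rlra.
have lG : lower_semicontinuous G.
  apply: lsc_addr => // x d d0; apply/nbhs_enormP.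
  have z1 : 0 < enorm z + 1 by have := enorm_ge0 z; rlra.
  exists (d / (enorm z + 1)); first by rewrite divr_gt0.
  move=> y /=; rewrite ltr_pdivlMr // => yx.
  have := dot_le_enorm z (y - x); have := enorm_ge0 (y - x).
  rewrite !dotE => h1 h2; rnra.
have Gp : G p = (a - dot z p)%:E by rewrite /G hpa -EFinD dotNl.
have GS v : Sph v -> ((a - dot z p)%:E < G v)%E.
  move=> vS; rewrite -Gp lt_neqAle; apply/andP; split; last first.
    rewrite Gp /G; have := hpz' v; case: (h v) => [b| |] //; last first.
      by rewrite addye ?leey.
    by rewrite -EFinD !lee_fin !dotE => h1; rlra.
  (* Equality would make [v] another minimiser of [G], hence another subgradient of the conjugate at
     [z]. *)
  apply/eqP => Gv; suff vp : v = p.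
    by move: vS e0; rewrite /Sph /= vp subrr enorm0 => <-; rewrite ltxx.
  apply: (subdiff_conjugate_unique ph hi hs _ hzp).
  apply: subdiff_conjugate; apply/subdiffP; move: Gv; rewrite Gp /G.
  case: (h v) (hN v) => [b| |] // _ []; rewrite dotNl => abv.
  exists b => // y; apply: le_trans (hpz' y); rewrite lee_fin.
  by rewrite !dotE; rlra.
have [d d0 dG] := lsc_compact_gap cS lG GS.
(* [G] exceeds its minimum [G p] by at least [d] on the sphere of radius [e],
   hence by at least [d/e * |v - p|] outside it. *)
exists (d / e); first by rewrite divr_gt0.
move=> z' z'd; apply: conjugate_le => v; have := hN v.
case hv : (h v) => [b| |] // _; last by rewrite leNye.
rewrite -EFinB lee_fin cE.
pose D := enorm (v - p).
have nz := enorm_ge0 (z' - z).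
have D0 : 0 <= D by exact: enorm_ge0.
have zv := dot_le_enorm (z' - z) (v - p); rewrite -/D in zv.
(* The subtracted parenthesis is [G v - G p], the growth that must absorb the cross term. *)
have zE : dot z' v - b = dot z p - a + dot p (z' - z) + dot (z' - z) (v - p)
    - (b - a - dot z (v - p)).
  by rewrite !dotE (dotC p z') (dotC p z); ring.
rewrite zE; have := hpz' v; rewrite hv lee_fin => bv.
have [De|eD] := leP D e.
  have : enorm (z' - z) * D <= e * enorm (z' - z) by rewrite mulrC ler_wpM2r.
  move: zv bv; rewrite !dotE; rlra.
have {}D0 : 0 < D by rlra.
pose l := e / D; pose u := l *: v + (1 - l) *: p.
have l01 : 0 < l < 1 by rewrite divr_gt0 //= ltr_pdivrMr // mul1r.
have uS : Sph u.
  have -> : u = p + l *: (v - p) by rewrite /u; vector_ring.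
  rewrite /Sph /= addrC addKr enormZ gtr0_norm; last by case/andP: l01.
  by rewrite -/D /l divfK // gt_eqF.
have := dG u uS; have := ch v p l l01; rewrite -/u hv hpa -!EFinM -EFinD /G.
case: (h u) => [f| |] //; rewrite -EFinD lte_fin lee_fin => h1 h2.
have {h1 h2} h3 : d < l * (b - a - dot z (v - p)).
  by move: h2 h1; rewrite /u !dotE => h2 h1; rlra.
have h4 : d / e * D < b - a - dot z (v - p).
  have -> : d / e * D = d / l by rewrite /l; field; rewrite !gt_eqF.
  by rewrite ltr_pdivrMr ?[_ * l]mulrC //; case/andP: l01.
have h5 : enorm (z' - z) * D <= d / e * D by rewrite ler_pM2r // ltW.
have h6 : 0 <= e * enorm (z' - z) by rewrite mulr_ge0 // ltW.
rlra.
Qed.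

End Duality.

(** * Closedness of subdifferentials, normal cones and Frechet subgradients *)

Section Limits.
Context {R : realType} {m : nat}.
Implicit Types (h : 'cV[R]_m -> \bar R) (C : set 'cV[R]_m).

Lemma cvg_dot (u_ v_ : nat -> 'cV[R]_m) u v : u_ @ \oo --> u -> v_ @ \oo --> v ->
  (fun k => dot (u_ k) (v_ k)) @ \oo --> dot u v.
Proof.
move=> cu cv; rewrite /dot.
apply: (cvg_big (op := +%R)) => /=; first exact: add_continuous.
move=> i _; apply: cvgM.
  exact: (cvg_comp _ (fun w : 'cV[R]_m => w i 0) cu (@coord_continuous _ _ _ i 0 u)).
exact: (cvg_comp _ (fun w : 'cV[R]_m => w i 0) cv (@coord_continuous _ _ _ i 0 v)).
Qed.

Lemma cvg_mulmx a (M : 'M[R]_(a, m)) (u_ : nat -> 'cV[R]_m) u :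
  u_ @ \oo --> u -> (fun k => M *m u_ k) @ \oo --> M *m u.
Proof.
move=> /cvg_enormP cu; apply/cvg_enormP => e e0.
have [C C0 MC] := enorm_mulmx_bound M.
have C1 : 0 < C + 1 by lra.
have [N uN] := cu (e / (C + 1)) (divr_gt0 e0 C1).
exists N => k Nk; rewrite -mulmxBr; apply: le_lt_trans (MC _) _.
have := uN k Nk; rewrite ltr_pdivlMr // => h1.
have := enorm_ge0 (u_ k - u); nra.
Qed.

(** Semicontinuity is used through the reals [c] below [h q]: each passes to the limit in the
    subgradient inequality, which yields both finiteness of [h q] and the limit inequality. *)
Lemma subdiff_closed h (q_ y_ : nat -> 'cV[R]_m) q y : eproper h ->
  lower_semicontinuous h -> (forall k, subdiff h (q_ k) (y_ k)) ->
  q_ @ \oo --> q -> y_ @ \oo --> y -> subdiff h q y.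
Proof.
move=> [hN [x0 hx0]] lh hqy cq cy.
have key (c : R) v b : (c%:E < h q)%E -> h v = b%:E -> c <= b - dot y (v - q).
  move=> /lh[V Vq Vc] hv.
  have cd : (fun k => b - dot (y_ k) (v - q_ k)) @ \oo --> b - dot y (v - q).
    apply: cvgB; first exact: cvg_cst.
    by apply: cvg_dot => //; apply: cvgB => //; exact: cvg_cst.
  have Vn : \forall k \near \oo, V (q_ k) := cq _ Vq.
  apply: (cvgr_to_ge cd); apply: filterS Vn => k Vk.
  have /subdiffP[a ha /(_ v)] := hqy k.
  by have := Vc _ Vk; rewrite ha hv lte_fin lee_fin; rlra.
have keyE v b : h v = b%:E -> (h q <= (b - dot y (v - q))%:E)%E.
  move=> hv; rewrite leNgt; apply/negP => /lte_fin_gap[e e0] he.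
  by have := key _ _ _ he hv; rewrite gerDl leNgt e0.
have [b0 hb0] : exists b, h x0 = b%:E.
  by move: (hN x0) hx0; case: (h x0) => [b| |] //; exists b.
have [a ha] : exists a, h q = a%:E.
  by move: (hN q) (keyE _ _ hb0); case: (h q) => [a| |] //; exists a.
apply/subdiffP; exists a => // v; have := hN v.
case hv : (h v) => [b| |] // _; last by rewrite leey.
by have := keyE _ _ hv; rewrite ha !lee_fin; rlra.
Qed.

Lemma proj_normal_cone C w x : convex_set C -> proj_on C w x ->
  normal_cone C x (w - x).
Proof.
move=> /convex_setP cC [Cx min_x]; split=> // c Cc.
apply: (@le0_of_small _ _ (1 / 2 * enorm (c - x) ^+ 2)) => l l01.
have := min_x _ (cC c x l Cc Cx l01); rewrite lee_fin => h1.
have h2 : enorm (x - w) ^+ 2 <= enorm (l *: c + (1 - l) *: x - w) ^+ 2.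
  by rewrite ler_sqr // nnegrE enorm_ge0.
have /andP[l0 l1] := l01; rewrite -(ler_pM2l l0).
move: h2; have -> : l *: c + (1 - l) *: x - w = (x - w) + l *: (c - x).
  by vector_ring.
by rewrite !sqr_enorm !dotE (dotC c x) (dotC c w) (dotC x w); rlra.
Qed.

(** When [C] has an interior point its affine hull is the whole space, so relative and ordinary
    neighbourhoods coincide. *)
Lemma relint_interior C a : interior C !=set0 -> relint C a -> interior C a.
Proof.
move=> [c /nbhs_enormP[e e0 ce]] [_]; rewrite /interior /within /=.
suff H v : affine_hull C v.
  by apply: filterS => x; apply; exact: H.
move=> M [aM CM]; pose d := enorm (v - c) + 1.
have d0 : 0 < d by have := enorm_ge0 (v - c); rewrite /d; rlra.
(* Dividing by [t] contracts [v] towards [c] until [y] falls in the ball of radius [e]; then [v] is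
   an affine combination of [y] and [c]. *)
pose t := 2 * d / e; have t0 : 0 < t by rewrite divr_gt0 // mulr_gt0.
pose y := c + t^-1 *: (v - c).
have -> : v = t *: y + (1 - t) *: c.
  by rewrite /y; apply/matrixP => i j; rewrite !mxE; field; rewrite gt_eqF.
apply: aM; apply: CM; last by apply: ce; rewrite subrr enorm0.
apply: ce; rewrite /y addrC addKr enormZ gtr0_norm ?invr_gt0 //.
rewrite mulrC ltr_pdivrMr // /t.
have -> : e * (2 * d / e) = 2 * d by field; rewrite gt_eqF.
by rewrite /d; have := enorm_ge0 (v - c); rlra.
Qed.

(** Moving from [q] by [r / 2] in the direction of [y] raises [h] by at least [r / 2 * enorm y],
    while [h] stays between fixed bounds on the ball of radius [r]. *)
Lemma subdiff_locally_bounded h a : econvex h -> (forall x, -oo < h x)%E ->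
  interior (edom h) a ->
  exists r B : R, 0 < r /\
    forall q y, enorm (q - a) <= r -> subdiff h q y -> enorm y <= B.
Proof.
move=> ch hN hi; have [r [M [r0 hM]]] := econvex_locally_bounded ch hN hi.
have [fa ha] : exists fa, h a = fa%:E.
  have : (h a <= M%:E)%E by apply: hM; rewrite subrr enorm0 ltW.
  by move: (hN a); case: (h a) => [fa| |] //; exists fa.
have mino := econvex_conic_minorant ch hN ha r0 hM.
have M0 : fa <= M.
  by rewrite -lee_fin -ha hM // subrr enorm0 ltW.
move: mino; set L := (M - fa) / r => mino.
have L0 : 0 <= L by apply: divr_ge0; [rewrite subr_ge0|exact: ltW].
exists (r / 2), ((M - fa + L * r) / (r / 2)); split; first by rewrite divr_gt0.
move=> q y qa /subdiffP[b hq hqy].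
have r2 : 0 < r / 2 by rewrite divr_gt0.
have [y0|y0] := eqVneq (enorm y) 0.
  by rewrite y0 divr_ge0 ?(ltW r2) // addr_ge0 ?subr_ge0 // mulr_ge0 // ltW.
have {}y0 : 0 < enorm y by rewrite lt_def y0 enorm_ge0.
pose v := q + (r / 2 / enorm y) *: y.
have nv : enorm (v - q) = r / 2.
  rewrite /v addrC addKr enormZ gtr0_norm ?divr_gt0 //.
  by rewrite divfK // gt_eqF.
have hv : (h v <= M%:E)%E.
  by apply: hM; have := enorm_triangle v q a; rewrite nv; rlra.
have := le_trans (hqy v) hv; rewrite lee_fin.
have -> : dot y (v - q) = r / 2 * enorm y.
  by rewrite /v addrC addKr dotZr -sqr_enorm; field; rewrite gt_eqF.
have := mino q; rewrite hq lee_fin => h1 h2.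
have h3 : L * enorm (q - a) <= L * r by rewrite ler_wpM2l //; rlra.
by rewrite ler_pdivlMr // mulrC; rlra.
Qed.

(** A negative lower limit would leave, in every punctured neighbourhood, a difference quotient
    below some fixed [- e]. *)
Lemma frechet_subdiffI h x v : h x \is a fin_num ->
  (forall e : R, 0 < e -> exists2 d : R, 0 < d & forall w, enorm (w - x) < d ->
    (h x + (dot v (w - x) - e * enorm (w - x))%:E <= h w)%E) ->
  frechet_subdiff h x v.
Proof.
move=> hx hv; split=> //; rewrite limf_einfE.
rewrite leNgt; apply/negP => sup0.
have [e e0 supe] : exists2 e : R, 0 < e &
    (forall V, x^' V -> exists2 w, V w &
      ((h w - h x - (dot v (w - x))%:E) * ((enorm (w - x))^-1)%:E < (- e)%:E)%E).
  have [e e0 he] : exists2 e : R, 0 < e &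
      (ereal_sup [set ereal_inf [set (h w - h x - (dot v (w - x))%:E) *
       ((enorm (w - x))^-1)%:E | w in V]%E | V in x^'] < (- e)%:E)%E.
    move: sup0; case: (ereal_sup _) => [a| |] //.
      by rewrite lte_fin => a0; exists (- a / 2); rewrite ?lte_fin; rlra.
    by move=> _; exists 1 => //; rewrite ltNyr.
  exists e => // V xV; apply/not_exists2P => noV.
  move: he; apply/negP; rewrite -leNgt; apply: le_ereal_sup_tmp.
  eexists; first by exists V.
  apply/ereal_infP => _ [w Vw <-].
  by have [//|/negP] := noV w; rewrite -leNgt.
have [d d0 hd] := hv _ e0; clear sup0.
have [|w [wd wx]] := supe [set w | enorm (w - x) < d /\ w != x].
  rewrite /dnbhs /within /=; apply/nbhs_enormP; exists d => //.
have nw : 0 < enorm (w - x).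
  rewrite lt_def enorm_ge0 andbT; apply: contra_neq wx => /enorm_eq0/eqP.
  by rewrite subr_eq0 => /eqP.
have := hd w wd; rewrite -(fineK hx); case: (h w) => [a| |] //.
  rewrite -!EFinD lee_fin -EFinM lte_fin ltr_pdivrMr // => h1 h2; rlra.
by rewrite !addye // gt0_mulye // lte_fin invr_gt0.
Qed.

Lemma limiting_of_frechet h x v : frechet_subdiff h x v -> limiting_subdiff h x v.
Proof.
move=> hv; split; first by case: hv.
by exists (fun=> x), (fun=> v); split=> //; exact: cvg_cst.
Qed.

End Limits.

Lemma cvg_usubmx {R : realType} m1 m2 (u : nat -> 'cV[R]_(m1 + m2)) (v : 'cV[R]_(m1 + m2)) :
  u @ \oo --> v -> (fun k => usubmx (u k)) @ \oo --> usubmx v.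
Proof.
move=> /cvg_enormP cu; apply/cvg_enormP => e e0; have [N HN] := cu _ e0.
exists N => k Nk; apply: le_lt_trans (HN k Nk).
by rewrite -linearB; exact: enorm_usubmx.
Qed.

Lemma cvg_dsubmx {R : realType} m1 m2 (u : nat -> 'cV[R]_(m1 + m2)) (v : 'cV[R]_(m1 + m2)) :
  u @ \oo --> v -> (fun k => dsubmx (u k)) @ \oo --> dsubmx v.
Proof.
move=> /cvg_enormP cu; apply/cvg_enormP => e e0; have [N HN] := cu _ e0.
exists N => k Nk; apply: le_lt_trans (HN k Nk).
by rewrite -linearB; exact: enorm_dsubmx.
Qed.

(** * Functions with Lipschitz gradient *)

Section Gradient.
Context {R : realType} {n : nat} (phi : 'cV[R]_n -> R).
Hypothesis dphi : forall v, differentiable phi v.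

Lemma derive_gradient x v : 'D_v phi x = dot (gradient phi x) v.
Proof.
rewrite deriveE // {1}(vec_sum_delta v) linear_sum; apply: eq_bigr => i _.
by rewrite linearZ /= mxE -deriveE // mulrC.
Qed.

Lemma is_derive_line (x d : 'cV[R]_n) (t : R) :
  is_derive t (1 : R) (fun t : R => phi (x + t *: d)) (dot (gradient phi (x + t *: d)) d).
Proof.
have E : (fun h : R => h^-1 *: (((fun t => phi (x + t *: d)) \o shift t) (h *: 1)
      - phi (x + t *: d))) =
    (fun h => h^-1 *: ((phi \o shift (x + t *: d)) (h *: d) - phi (x + t *: d))).
  apply/funext => h /=; congr (_ *: (phi _ - _)).
  by apply/matrixP => i j; rewrite !mxE /GRing.scale /=; ring.
have D := @diff_derivable _ _ _ phi (x + t *: d) d (dphi _).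
split; first by rewrite /derivable E.
by rewrite /derive E -derive_gradient.
Qed.

Variable ell : R.
Hypothesis lip : forall v w,
  enorm (gradient phi v - gradient phi w) <= ell * enorm (v - w).

(** The mean value theorem is applied to [h], from which the claimed quadratic has been subtracted;
    Cauchy-Schwarz and the Lipschitz bound make its derivative nonpositive on the open unit
    interval. *)
Lemma descent_upper x y :
  phi y <= phi x + dot (gradient phi x) (y - x) + ell / 2 * enorm (y - x) ^+ 2.
Proof.
pose d := y - x; pose G := dot (gradient phi x) d.
pose h (t : R) := phi (x + t *: d) - t * G - t ^+ 2 * (ell / 2 * enorm d ^+ 2).
pose dh (t : R) := dot (gradient phi (x + t *: d)) d - G - t * (ell * enorm d ^+ 2).
have hd (t : R) : is_derive t (1 : R) h (dh t).
  have H := is_derive_line x d t.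
  rewrite /h; apply: is_derive_eq; rewrite /dh /GRing.scale /=.
  by field.
have [c c01] : exists2 c : R, c \in `]0, 1[ & h 1 - h 0 = dh c * (1 - 0).
  apply: MVT => //.
  apply: derivable_within_continuous => t _.
  by have [] := hd t.
rewrite subr0 mulr1 => h10; have c0 : 0 < c by move: c01; rewrite in_itv /= => /andP[].
have : dh c <= 0.
  rewrite /dh /G -dotNl -dotDl.
  have := dot_le_enorm (gradient phi (x + c *: d) - gradient phi x) d.
  have := lip (x + c *: d) x; rewrite addrAC subrr add0r enormZ gtr0_norm //.
  have := enorm_ge0 d => d0 h1 h2.
  have : enorm (gradient phi (x + c *: d) - gradient phi x) * enorm d
      <= ell * (c * enorm d) * enorm d by rewrite ler_wpM2r.
  lra.
have xd : x + d = y by rewrite /d addrC subrK.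
by rewrite -h10 /h scale1r scale0r addr0 xd /G; lra.
Qed.

End Gradient.

Lemma gradientN {R : realType} {n} (phi : 'cV[R]_n -> R) x :
  differentiable phi x -> gradient (fun v => - phi v) x = - gradient phi x.
Proof.
move=> dphi; apply/matrixP => i j; rewrite !mxE deriveN //.
exact: diff_derivable.
Qed.

Lemma descent_lower {R : realType} {n} (phi : 'cV[R]_n -> R) (ell : R) :
  (forall v, differentiable phi v) ->
  (forall v w, enorm (gradient phi v - gradient phi w) <= ell * enorm (v - w)) ->
  forall x y,
  phi x + dot (gradient phi x) (y - x) - ell / 2 * enorm (y - x) ^+ 2 <= phi y.
Proof.
move=> dphi lip x y.
have := @descent_upper _ _ (fun v => - phi v) _ ell _ x y.
rewrite gradientN // dotNl => H.
suff : - phi y <= - phi x - dot (gradient phi x) (y - x) + ell / 2 * enorm (y - x) ^+ 2 by lra.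
apply: H => [v|v w]; first exact: differentiableN.
by rewrite !gradientN // -opprD enormN.
Qed.

Lemma gradient_cvg {R : realType} {n} (phi : 'cV[R]_n -> R) (ell : R)
    (u : nat -> 'cV[R]_n) (ub : 'cV[R]_n) : 0 < ell ->
  (forall v w, enorm (gradient phi v - gradient phi w) <= ell * enorm (v - w)) ->
  u @ \oo --> ub -> (fun k => gradient phi (u k)) @ \oo --> gradient phi ub.
Proof.
move=> ell0 lip /cvg_enormP cu; apply/cvg_enormP => e e0.
have [N HN] := cu (e / ell) (divr_gt0 e0 ell0).
exists N => k Nk; apply: le_lt_trans (lip _ _) _.
by have := HN k Nk; rewrite ltr_pdivlMr // mulrC.
Qed.

(** * Convergence from the Kurdyka-Lojasiewicz inequality *)

Section KurdykaLojasiewicz.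
Context {R : realType}.

(** If the chord slope were below the derivative, difference quotients just left of [s] would exceed
    it, whereas concavity keeps the graph above the chord there. *)
Lemma concave_tangent (phi : R -> R) (s t : R) : t <= s ->
  (forall l : R, 0 <= l <= 1 ->
    l * phi t + (1 - l) * phi s <= phi (l * t + (1 - l) * s)) ->
  derivable phi s 1 -> derive1 phi s * (s - t) <= phi s - phi t.
Proof.
rewrite le_eqVlt => /orP[/eqP ->|ts] cc dphi; first by rewrite !subrr mulr0.
have st : 0 < s - t by lra.
rewrite leNgt -ltr_pdivrMr //; apply/negP => ltsl.
have cvd : (fun h : R => h^-1 *: ((phi \o shift s) (h *: (1 : R)) - phi s)) @ 0^' -->
    derive1 phi s by rewrite derive1E.
have : \forall h \near (0 : R)^',
    (phi s - phi t) / (s - t) < h^-1 *: ((phi \o shift s) (h *: (1 : R)) - phi s).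
  exact: (cvgr_gt _ cvd).
rewrite /dnbhs /within /= => /nbhs_ballP[d /= d0 hd].
(* The first bound keeps [l] in the unit interval, the second keeps [s + h] where the difference
   quotient is controlled. *)
pose l := Num.min (1 / 2) (d / (2 * (s - t))).
have l0 : 0 < l by rewrite lt_min !divr_gt0 // mulr_gt0.
have l1 : l <= 1 / 2 by rewrite ge_min lexx.
have ld : l * (s - t) <= d / 2.
  rewrite -ler_pdivlMr // (_ : d / 2 / (s - t) = d / (2 * (s - t))) ?ge_min ?lexx ?orbT //.
  by field; rewrite gt_eqF.
pose h := - (l * (s - t)).
have h0 : h < 0 by rewrite /h oppr_lt0 mulr_gt0.
have := hd h; rewrite -ball_normE /= sub0r normrN ltr0_norm //.
have -> : - h < d by rewrite /h; lra.
rewrite lt_eqF // => /(_ isT isT).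
have l01 : 0 <= l <= 1 by lra.
have := cc l l01; have -> : l * t + (1 - l) * s = s + h by rewrite /h; ring.
rewrite /GRing.scale /= mulr1 [h + s]addrC => h1.
rewrite [h^-1 * _]mulrC; have -> : (phi s - phi t) / (s - t) = - l * (phi s - phi t) / h.
  by rewrite /h; field; rewrite !gt_eqF.
rewrite ltr_ndivrMr // divfK ?lt_eqF //; lra.
Qed.

Section Capture.
Variables (m : nat) (w : nat -> 'cV[R]_m) (wb : 'cV[R]_m) (D H : nat -> R).
Variables (Hs a b e0 : R) (eta : \bar R) (phi : R -> R).
Hypotheses (a0 : 0 < a) (b0 : 0 < b) (e00 : 0 < e0) (eta0 : (0 < eta)%E).
Hypothesis dphi : desingularizing eta phi.
Hypothesis D0 : forall k, 0 <= D k.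
Hypothesis decrease : forall k, H k.+1 + a * D k.+1 ^+ 2 <= H k.
Hypothesis Hlow : forall k, Hs <= H k.
Hypothesis Hcvg : forall e : R, 0 < e -> exists N, forall k, (N <= k)%N -> H k < Hs + e.
Hypothesis step : forall k, enorm (w k.+1 - w k) <= D k.+1 + D k.
Hypothesis KL : forall k, enorm (w k - wb) < e0 -> Hs < H k ->
  ((H k - Hs)%:E < eta)%E -> 1 <= derive1 phi (H k - Hs) * (b * D k).
Hypothesis clus : forall (e : R) N, 0 < e ->
  exists2 k, (N <= k)%N & enorm (w k - wb) < e.

Let p k := phi (H k - Hs).

(** Concavity bounds the derivative times [a * D k.+1 ^+ 2] by [p k - p k.+1], the KL inequality
    bounds the derivative below by [1 / (b * D k)], and the arithmetic-geometric mean inequality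
    separates the factors. *)
Lemma KL_step k : enorm (w k - wb) < e0 -> ((H k - Hs)%:E < eta)%E ->
  2 * D k.+1 <= D k + b / a * (p k - p k.+1).
Proof.
move=> wk Hk; have [phi0 _ _ cc dp] := dphi.
have dk := decrease k; have Dk := D0 k; have Dk1 := D0 k.+1.
have sk := sqr_ge0 (D k.+1).
have ask : 0 <= a * D k.+1 ^+ 2 by rewrite mulr_ge0 // ltW.
(* At the limiting value, where KL says nothing, the decrease forces [D k.+1 = 0] and both values of
   [p] agree. *)
have [Hk0|Hk0] := eqVneq (H k) Hs.
  have H1 : H k.+1 = Hs by apply/eqP; rewrite eq_le Hlow andbT; lra.
  have : D k.+1 ^+ 2 = 0.
    by apply/eqP; rewrite eq_le sk andbT -(ler_pM2l a0) mulr0; lra.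
  move/eqP; rewrite sqrf_eq0 => /eqP ->.
  by rewrite /p Hk0 H1 subrr mulr0 mulr0 addr0.
have Hlt : Hs < H k by rewrite lt_def Hk0 Hlow.
have Hk1 : 0 < H k - Hs by lra.
have [dpk _ P0] := dp (H k - Hs) Hk1 Hk.
have kl := KL wk Hlt Hk.
have tan : derive1 phi (H k - Hs) * (H k - Hs - (H k.+1 - Hs)) <= p k - p k.+1.
  apply: concave_tangent => // [|l l01]; first lra.
  apply: cc => //; split; rewrite ?subr_ge0 ?Hlow //.
    by apply: le_lt_trans Hk; rewrite lee_fin; lra.
move: P0 kl tan; set P := derive1 phi _ => P0 kl tan.
have h1 : P * (a * D k.+1 ^+ 2) <= p k - p k.+1.
  by apply: le_trans tan; rewrite ler_pM2l //; lra.
have h2 : P * b * D k.+1 ^+ 2 <= b / a * (p k - p k.+1).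
  have -> : P * b * D k.+1 ^+ 2 = b / a * (P * (a * D k.+1 ^+ 2)).
    by field; rewrite gt_eqF.
  by rewrite ler_pM2l // divr_gt0.
have Dp : 0 < D k.
  by rewrite lt_def Dk andbT; apply: contraTneq kl => ->; rewrite !mulr0 -ltNge.
apply: (@le_trans _ _ (D k + P * b * D k.+1 ^+ 2)); last by lra.
rewrite -(ler_pM2l Dp).
have h3 : 1 * D k.+1 ^+ 2 <= P * (b * D k) * D k.+1 ^+ 2 by rewrite ler_wpM2r.
have := sqr_ge0 (D k - D k.+1); lra.
Qed.

(* The telescoped inequality traps the sequence in any given ball around the
   cluster point [wb] as soon as it enters a smaller ball late enough. *)
Lemma KL_capture : w @ \oo --> wb.
Proof.
apply/cvg_enormP => e' e'0.
pose e := Num.min e' e0; have ee0 : 0 < e by rewrite lt_min e'0.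
have [phi0 phige0 phic _ _] := dphi.
have C0 : 0 < b / a by rewrite divr_gt0.
have p_ge0 k : ((H k - Hs)%:E < eta)%E -> 0 <= p k.
  by move=> Hk; apply: phige0; split; rewrite // subr_ge0.
have [N1 HN1] : exists N, forall k, (N <= k)%N -> ((H k - Hs)%:E < eta)%E.
  have [d d0 hd] : exists2 d : R, 0 < d & (d%:E < eta)%E.
    by have [d d0] := lte_fin_gap eta0; rewrite add0r; exists d.
  have [N HN] := Hcvg d0; exists N => k Nk.
  by apply: lt_trans hd; rewrite lte_fin; have := HN k Nk; lra.
have [N2 HN2] : exists N, forall k, (N <= k)%N -> b / a * p k < e / 8.
  have e8 : 0 < e / 8 / (b / a) by rewrite !divr_gt0.
  have : \forall t \near within [set t : R | 0 <= t /\ (t%:E < eta)%E] (nbhs (0 : R)),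
      phi t < e / 8 / (b / a).
    have c0 : phi @ within [set t : R | 0 <= t /\ (t%:E < eta)%E] (nbhs (0 : R)) -->
        phi 0.
      by move/subspace_continuousP : phic; apply; split.
    by apply: (cvgr_lt _ c0); rewrite phi0.
  rewrite /within /= => /nbhs_ballP[d /= d0 hd].
  have [N HN] := Hcvg d0; exists (maxn N N1) => k; rewrite geq_max => /andP[Nk N1k].
  rewrite mulrC -ltr_pdivlMr //; apply: hd; last first.
    by split; [rewrite subr_ge0|exact: HN1].
  rewrite -ball_normE /= sub0r normrN ger0_norm ?subr_ge0 //.
  by have := HN k Nk; lra.
have [N3 HN3] : exists N, forall k, (N <= k)%N -> D k < e / 8.
  have d0 : 0 < a * (e / 8) ^+ 2 by rewrite mulr_gt0 // exprn_gt0 // divr_gt0.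
  (* [D k.+1] is controlled by the drop from [H k] to [H k.+1], hence the shifted index. *)
  have [N HN] := Hcvg d0; exists N.+1 => -[//|k]; rewrite ltnS => Nk.
  have h1 : a * D k.+1 ^+ 2 < a * (e / 8) ^+ 2.
    by have := decrease k; have := Hlow k.+1; have := HN k Nk; lra.
  rewrite ltr_pM2l // in h1.
  by rewrite -ltr_sqr ?nnegrE ?D0 // divr_ge0 // ltW.
have [N NN wN] := clus (maxn N1 (maxn N2 N3)) (divr_gt0 ee0 (ltr0n R 8)).
move: NN; rewrite !geq_max => /and3P[NN1 NN2 NN3].
pose E k := \sum_(N <= i < k) D i.+1.
(* The bounds are proved together: the first controls the path length, the second then keeps [w k]
   within [e0] of [wb], which permits [KL_step] at [k]. The errors of size [e / 8] add up to at most
   [6 * e / 8]. *)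
have inv k : (N <= k)%N ->
    E k + D k <= D N + b / a * (p N - p k) /\ enorm (w k - w N) <= 2 * E k + D N - D k.
  elim: k => [|k IH].
    rewrite leqn0 => /eqP N0; rewrite /E N0 big_geq // !subrr mulr0 enorm0.
    by split; lra.
  rewrite leq_eqVlt => /orP[/eqP <-|].
    by rewrite /E big_geq // !subrr mulr0 enorm0; split; lra.
  rewrite ltnS => Nk; have [h1 h2] := IH Nk.
  have pk := p_ge0 k (HN1 k (leq_trans NN1 Nk)).
  have Cp : 0 <= b / a * p k by rewrite mulr_ge0 // ltW.
  have hN2 := HN2 N NN2; have hN3 := HN3 N NN3; have Dk := D0 k.
  have wk : enorm (w k - wb) < e0.
    have := enorm_triangle (w k) (w N) wb.
    have : e <= e0 by rewrite ge_min lexx orbT.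
    lra.
  have := KL_step wk (HN1 k (leq_trans NN1 Nk)).
  have -> : E k.+1 = E k + D k.+1 by rewrite /E big_nat_recr.
  have := step k; have := enorm_triangle (w k.+1) (w k) (w N).
  by move=> h3 h4 h5; split; lra.
exists N => k Nk; have [h1 h2] := inv k Nk.
have pk := p_ge0 k (HN1 k (leq_trans NN1 Nk)).
have Cp : 0 <= b / a * p k by rewrite mulr_ge0 // ltW.
have hN2 := HN2 N NN2; have hN3 := HN3 N NN3; have Dk := D0 k.
have := enorm_triangle (w k) (w N) wb.
have : e <= e' by rewrite ge_min lexx.
lra.
Qed.

End Capture.
End KurdykaLojasiewicz.

(** * The adaptive algorithm *)

Section Lipschitz.
Context {R : realType} {m : nat}.
Implicit Types (h : 'cV[R]_m -> \bar R) (C : set 'cV[R]_m).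

(** The Lipschitz bound near [b] controls the slope at the start of the segment from [b] to [w];
    convexity extends the lower bound to its end, even outside [C]. *)
Lemma lipschitz_minorant h C b (fb l e0 : R) : econvex h ->
  (forall v, -oo < h v)%E -> lipschitz_const_on C h l -> h b = fb%:E -> 0 < e0 ->
  (forall v, enorm (v - b) <= e0 -> C v) ->
  forall w, ((fb - l * enorm (w - b))%:E <= h w)%E.
Proof.
move=> ch hN lip hb e00 bC w; have := hN w.
case hw : (h w) => [c| |] // _; last by rewrite leey.
rewrite lee_fin.
have [D0|D0] := eqVneq (enorm (w - b)) 0.
  have wb : w = b by apply/eqP; rewrite -subr_eq0 (enorm_eq0 D0).
  by move: hw; rewrite wb hb => -[->]; rewrite subrr enorm0 mulr0 subr0.
have {}D0 : 0 < enorm (w - b) by rewrite lt_def D0 enorm_ge0.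
move: D0; set D := enorm (w - b) => D0.
(* [t] puts [u] within [e0] of [b], where the Lipschitz bound holds. *)
pose t := Num.min (1 / 2) (e0 / D).
have t0 : 0 < t by rewrite lt_min !divr_gt0.
have t1 : t <= 1 / 2 by rewrite ge_min lexx.
have tD : t * D <= e0 by rewrite -ler_pdivlMr // ge_min lexx orbT.
pose u := t *: w + (1 - t) *: b.
have t01 : 0 < t < 1 by apply/andP; split; rlra.
have ub : enorm (u - b) = t * D.
  have -> : u - b = t *: (w - b) by rewrite /u; vector_ring.
  by rewrite enormZ gtr0_norm.
have Cu : C u by apply: bC; rewrite ub.
have Cb : C b by apply: bC; rewrite subrr enorm0 ltW.
have := ch w b t t01; have := lip u b Cu Cb; rewrite -/u ub hb hw -!EFinM -EFinD.
case: (h u) => [a| |] //; rewrite !lee_fin ler_norml => /andP[h1 _] h2.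
by rewrite -(ler_pM2l t0); rlra.
Qed.

(* Compare with the value at [b], the centre of a ball on which [h] is Lipschitz. *)
Lemma lipschitz_subgradient h C b w z (l e0 a : R) : econvex h ->
  (forall v, -oo < h v)%E -> 0 <= l -> lipschitz_const_on C h l -> 0 < e0 ->
  (forall v, enorm (v - b) <= e0 -> C v) -> (h b < +oo)%E ->
  0 < a -> b - w = a *: z -> subdiff h w z -> enorm z <= l.
Proof.
move=> ch hN l0 lip e00 bC hb a0 bw /subdiffP[c hw hz].
have [fb hbE] : exists fb, h b = fb%:E.
  by move: (hN b) hb; case: (h b) => [fb| |] //; exists fb.
have := lipschitz_minorant ch hN lip hbE e00 bC w; have := hz b.
rewrite enormB bw hbE hw !lee_fin enormZ dotZr -sqr_enorm gtr0_norm // => h1 h2.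
have [z0|z0] := eqVneq (enorm z) 0.
  by rewrite z0.
have {}z0 : 0 < enorm z by rewrite lt_def z0 enorm_ge0.
by rewrite -(ler_pM2l z0) -(ler_pM2l a0); rlra.
Qed.

End Lipschitz.

(** * Finiteness of the number of parameter updates *)

Section AdaptiveUpdate.
Context {R : realType} {s : nat}.
Variables (alpha gamma eps : R) (z : nat -> 'cV[R]_s) (al : nat -> R).
Hypothesis gamma0 : 0 < gamma.
Hypothesis upd : adaptive_update alpha gamma eps z al.

Lemma adaptive_bounds k : alpha < al k <= alpha + gamma.
Proof.
have [a [j [[_ aP] _ a0 _ /(_ k)[-> _]]]] := upd.
have [_ h _ _] := aP (j k); rewrite -a0 h andbT.
case: (j k) => [|i]; first by rewrite a0 ltrDl.
by have [_ _ _] := aP i.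
Qed.

(** Once [a i - alpha <= eps / B] the test cannot succeed, so the update count [j k] never exceeds
    [J]; being monotone, it is eventually equal to its maximum. *)
Lemma adaptive_stationary (B : R) : 0 < B -> 0 < eps ->
  (forall k, enorm (z k) <= B) ->
  exists K0 ta, alpha < ta /\ forall k, (K0 <= k)%N ->
    al k = ta /\ (al k - alpha) * enorm (z k.+1) <= eps.
Proof.
move=> B0 eps0 zB; have [a [j [[acvg aP] _ a0 j0 jP]]] := upd.
have [J HJ] : exists J, forall i, (J <= i)%N -> (a i - alpha) * B <= eps.
  have : \forall i \near \oo, a i < alpha + eps / B.
    by apply: (cvgr_lt _ acvg); rewrite ltrDl divr_gt0.
  move=> [J _ HJ]; exists J => i Ji; rewrite -ler_pdivlMr //.
  by have := HJ i Ji; rewrite /=; lra.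
have aalpha i : alpha < a i.
  by case: i => [|i]; [rewrite a0 ltrDl|have [] := aP i].
have jJ k : (j k <= J)%N.
  elim: k => [|k IH]; first by rewrite j0.
  have [alk ->] := jP k; case: ifP => // test.
  rewrite ltn_neqAle IH andbT; apply/eqP => jk.
  move: test; rewrite alk jk ltNge => /negP; apply.
  apply: le_trans (HJ J (leqnn J)); rewrite ler_wpM2l //.
  by rewrite subr_ge0 ltW.
have jmono k i : (j k <= j (k + i))%N.
  elim: i => [|i IH]; first by rewrite addn0.
  apply: leq_trans IH _; rewrite addnS; have [_ ->] := jP (k + i)%N.
  by case: ifP.
have [] := @ex_maxnP (fun i => `[< exists k, j k = i >]) J.
- by exists (j 0%N); apply/asboolP; exists 0%N.
- by move=> i /asboolP[k <-].
move=> i /asboolP[K0 <-] jmax.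
have jE k : (K0 <= k)%N -> j k = j K0.
  move=> Kk; apply/eqP; rewrite eqn_leq jmax; last by apply/asboolP; exists k.
  by rewrite -(subnKC Kk) jmono.
exists K0, (a (j K0)); split=> // k Kk.
have [alk] := jP k; rewrite (jE k Kk) jE ?(leq_trans Kk) //.
(* A successful test from step [K0] on would increase the maximal count. *)
case: ifP => [_ /eqP|]; first by rewrite -[X in X == _]addn0 -addn1 eqn_add2l.
by rewrite ltNge => /negbFE h _; split=> //; rewrite alk jE.
Qed.

End AdaptiveUpdate.

Section Enlargement.
Context {R : realType} {n s : nat} (S : set 'cV[R]_n) (A : 'M[R]_(s, n)).

Lemma enlargementI (r : R) v w : S v -> enorm (w - A *m v) <= r ->
  enlargement S A r w.
Proof.
move=> Sv wr; rewrite /enlargement /= /dist_to.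
apply: ge_ereal_inf; exists (enorm (w - A *m v))%:E; last by rewrite lee_fin.
by exists (A *m v) => //; exists v.
Qed.

End Enlargement.

(** * The merit function and its Frechet subgradients *)

Section Merit.
Context {R : realType} {n p s : nat}.
Variables (S : set 'cV[R]_n) (f : 'cV[R]_p -> \bar R) (g : 'cV[R]_s -> \bar R).
Variables (A : 'M[R]_(s, n)) (K : 'M[R]_(p, n)) (phi : 'cV[R]_n -> R).
Variables (alpha ta : R).

Definition prox_weight : R := alpha / 2 * (1 + 4 * alpha / (ta - alpha)).

(* The merit function at a point where it is finite; [a] and [b] stand for the
   values of the conjugates of [g] and [f]. *)
Definition merit_value (x : 'cV[R]_n) (y : 'cV[R]_p) (z u : 'cV[R]_s) (a b : R) : R :=
  dot z (A *m x) - a + phi x - dot (K *m x) y + b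
  + prox_weight * enorm (z - u) ^+ 2 - 2^-1 * (ta - alpha) * enorm z ^+ 2.

Lemma meritE x y z u a b : S x -> conjugate g z = a%:E -> conjugate f y = b%:E ->
  merit S f g A K phi alpha ta x y z u = (merit_value x y z u a b)%:E.
Proof.
move=> Sx gz fy; rewrite /merit gz fy /indicator_of mem_set // adde0.
by rewrite -!EFinN -!EFinD.
Qed.

(** With the conjugate of [g] finite at [z], the merit is [+oo] off [S] and wherever the conjugate
    of [f] is, so a lower bound has content only elsewhere. *)
Lemma merit_ge x y z u a (M : R) : conjugate g z = a%:E -> (-oo < conjugate f y)%E ->
  (forall b, S x -> conjugate f y = b%:E -> M <= merit_value x y z u a b) ->
  (M%:E <= merit S f g A K phi alpha ta x y z u)%E.
Proof.
move=> gz fyN Mb; have [Sx|Sx] := pselect (S x); last first.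
  rewrite /merit gz /indicator_of memNset //.
  by move: fyN; case: (conjugate f y) => [b| |] // _; rewrite leey.
case fy : (conjugate f y) fyN => [b| |] // _.
  by rewrite (meritE _ Sx gz fy) lee_fin; exact: Mb.
by rewrite /merit gz fy /indicator_of mem_set // leey.
Qed.

Lemma merit_vec_col x y z u :
  merit_vec S f g A K phi alpha ta (col_mx x (col_mx y (col_mx z u))) =
  merit S f g A K phi alpha ta x y z u.
Proof. by rewrite /merit_vec !col_mxKd !col_mxKu. Qed.

Hypothesis dphi : forall v, differentiable phi v.
Variable ell : R.
Hypothesis ell0 : 0 < ell.
Hypothesis lip : forall v w,
  enorm (gradient phi v - gradient phi w) <= ell * enorm (v - w).
Hypothesis pf : forall y, (-oo < conjugate f y)%E.
Hypotheses (pg : proper_convex_lsc g) (gi : interior (edom g) !=set0).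
Hypothesis gs : essentially_strictly_convex g.
Hypothesis alpha0 : 0 < alpha.
Hypothesis ta0 : alpha < ta.

(* [lra] does not see section hypotheses, hence their local copies below. *)
Lemma prox_weight_ge0 : 0 <= prox_weight.
Proof.
move: (alpha0) (ta0) => a0 t0.
have h : 0 <= 4 * alpha / (ta - alpha) by apply: divr_ge0; lra.
by apply: mulr_ge0; lra.
Qed.

(** Convex terms are minorised by their subgradients and [phi] by [descent_lower]; minus the
    conjugate of [g] is handled by [conjugate_differentiable]; bilinear terms leave errors quadratic
    in the displacement. *)
Lemma merit_frechet x y z u q v nu : S x -> normal_cone S x nu ->
  subdiff (conjugate f) y q -> subdiff (conjugate g) z v ->
  frechet_subdiff (merit_vec S f g A K phi alpha ta)
    (col_mx x (col_mx y (col_mx z u)))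
    (col_mx (A^T *m z + gradient phi x - K^T *m y + nu)
      (col_mx (q - K *m x)
        (col_mx (A *m x - v + (2 * prox_weight) *: (z - u) - (ta - alpha) *: z)
          ((2 * prox_weight) *: (u - z))))).
Proof.
move: (alpha0) (ta0) (ell0) => a0 t0 l0 Sx [_ nuS] fq gv.
have /subdiffP[b fyb fyq] := fq; have /subdiffP[a gza _] := gv.
have T0 := prox_weight_ge0; have c0 : 0 < ta - alpha by lra.
apply: frechet_subdiffI; rewrite merit_vec_col (meritE _ Sx gza fyb) // => e e0.
(* One half of [e] pays for the conjugate of [g], the other for the quadratic errors collected in
   [C]. *)
have [d1 d10 gd] := conjugate_differentiable pg gi gs gv gza (divr_gt0 e0 (ltr0n R 2)).
have [CA CA0 HA] := enorm_mulmx_bound A; have [CK CK0 HK] := enorm_mulmx_bound K.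
pose C := CA + CK + ell / 2 + (ta - alpha).
have C0 : 0 < C by rewrite /C; lra.
exists (Num.min d1 (e / 2 / C)); first by rewrite lt_min d10 !divr_gt0.
move=> w; rewrite lt_min => /andP[wd1 wd2].
rewrite -(vsubmxK w) -(vsubmxK (dsubmx w)) -(vsubmxK (dsubmx (dsubmx w))).
rewrite -(vsubmxK w) -(vsubmxK (dsubmx w)) -(vsubmxK (dsubmx (dsubmx w))) in wd1 wd2.
move: (usubmx w) (usubmx (dsubmx w)) (usubmx (dsubmx (dsubmx w)))
  (dsubmx (dsubmx (dsubmx w))) wd1 wd2 => x' y' z' u'.
rewrite merit_vec_col !opp_col_mx !add_col_mx !dot_col_mx.
set N := enorm _ => wd1 wd2.
have N0 : 0 <= N by exact: enorm_ge0.
have Nx : enorm (x' - x) <= N.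
  by have := enorm_usubmx (col_mx (x' - x) (col_mx (y' - y) (col_mx (z' - z) (u' - u))));
     rewrite col_mxKu.
have Nd := enorm_dsubmx (col_mx (x' - x) (col_mx (y' - y) (col_mx (z' - z) (u' - u)))).
rewrite col_mxKd -/N in Nd.
have Ny : enorm (y' - y) <= N.
  by have := enorm_usubmx (col_mx (y' - y) (col_mx (z' - z) (u' - u)));
     rewrite col_mxKu; lra.
have Ndd := enorm_dsubmx (col_mx (y' - y) (col_mx (z' - z) (u' - u))).
rewrite col_mxKd in Ndd.
have Nz : enorm (z' - z) <= N.
  by have := enorm_usubmx (col_mx (z' - z) (u' - u)); rewrite col_mxKu; lra.
have gz' := gd z' (le_lt_trans Nz wd1).
have [a' gza'] : exists a', conjugate g z' = a'%:E.
  move: gz' (conjugate_gtNy (let: And3 h _ _ := pg in h) z'); case: (conjugate g z') => [a'| |] //.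
  by exists a'.
rewrite gza' lee_fin in gz'.
apply: (merit_ge gza' (pf y')) => b' Sx' fyb'.
have fb : b + dot q (y' - y) <= b' by have := fyq y'; rewrite fyb' lee_fin.
have nx : dot nu (x' - x) <= 0 by exact: nuS.
have ph := descent_lower dphi lip x x'.
rewrite /merit_value.
have bil : - (CA * N ^+ 2) <= dot (z' - z) (A *m (x' - x)).
  apply: le_trans (dot_geN _ _); rewrite lerN2 mulrC expr2 mulrA.
  by apply: ler_pM => //; rewrite ?enorm_ge0 //; apply: le_trans (HA _) _; rewrite ler_wpM2l.
have bilK : dot (K *m (x' - x)) (y' - y) <= CK * N ^+ 2.
  apply: le_trans (dot_le_enorm _ _) _; rewrite expr2 mulrA.
  by apply: ler_pM => //; rewrite ?enorm_ge0 //; apply: le_trans (HK _) _; rewrite ler_wpM2l.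
have xN : enorm (x' - x) ^+ 2 <= N ^+ 2 by rewrite ler_sqr // nnegrE enorm_ge0.
have zN : enorm (z' - z) ^+ 2 <= N ^+ 2 by rewrite ler_sqr // nnegrE enorm_ge0.
have NN : C * N ^+ 2 <= e / 2 * N.
  rewrite expr2 mulrA ler_wpM2r // mulrC -ler_pdivlMr //; exact: ltW.
have ez : e / 2 * enorm (z' - z) <= e / 2 * N by rewrite ler_wpM2l // divr_ge0 // ltW.
(* The proximal term is convex, so its linearisation is a minorant without error. *)
have Tsq : prox_weight * enorm (z - u) ^+ 2 + dot ((2 * prox_weight) *: (z - u)) (z' - z)
    + dot ((2 * prox_weight) *: (u - z)) (u' - u) <= prox_weight * enorm (z' - u') ^+ 2.
  have := mulr_ge0 T0 (dot_ge0 ((z' - z) - (u' - u))).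
  rewrite !sqr_enorm !dotE.
  rewrite (dotC u' z') (dotC u z) (dotC z' z) (dotC z' u) (dotC u' z) (dotC u' u); lra.
have exA : dot z' (A *m x') = dot z (A *m x) + dot (z' - z) (A *m x)
    + dot (A^T *m z) (x' - x) + dot (z' - z) (A *m (x' - x)).
  by rewrite dot_trmx mulmxBr !dotE; ring.
have exK : dot (K *m x') y' = dot (K *m x) y + dot (K *m x) (y' - y)
    + dot (K^T *m y) (x' - x) + dot (K *m (x' - x)) (y' - y).
  by rewrite dot_trmx mulmxBr !dotE (dotC y (K *m x')) (dotC y (K *m x)); ring.
have exz : enorm z' ^+ 2 = enorm z ^+ 2 + 2 * dot z (z' - z) + enorm (z' - z) ^+ 2.
  by rewrite !sqr_enorm !dotE (dotC z' z); ring.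
have cz : (ta - alpha) * enorm (z' - z) ^+ 2 <= (ta - alpha) * N ^+ 2.
  by rewrite ler_wpM2l // ltW.
have ez2 : ell / 2 * enorm (x' - x) ^+ 2 <= ell / 2 * N ^+ 2.
  by rewrite ler_wpM2l // divr_ge0 // ltW.
have dE : dot (A^T *m z + gradient phi x - K^T *m y + nu) (x' - x)
  + (dot (q - K *m x) (y' - y)
  + (dot (A *m x - v + (2 * prox_weight) *: (z - u) - (ta - alpha) *: z) (z' - z)
  + dot ((2 * prox_weight) *: (u - z)) (u' - u)))
  = dot (A^T *m z) (x' - x) + dot (gradient phi x) (x' - x) - dot (K^T *m y) (x' - x)
  + dot nu (x' - x) + dot q (y' - y) - dot (K *m x) (y' - y)
  + dot (z' - z) (A *m x) - dot v (z' - z)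
  + dot ((2 * prox_weight) *: (z - u)) (z' - z) - (ta - alpha) * dot z (z' - z)
  + dot ((2 * prox_weight) *: (u - z)) (u' - u).
  rewrite !(dotDl (_ + _)) ![dot (_ + _) (x' - x)]dotDl ![dot (_ + _) (y' - y)]dotDl.
  rewrite ![dot (_ + _) (z' - z)]dotDl !(dotNl _ (_ - _)) (dotC (A *m x) (z' - z)).
  by rewrite (dotZl (ta - alpha)); ring.
rewrite dE exA exK exz.
have N2 : 0 <= (ta - alpha) * N ^+ 2 by rewrite mulr_ge0 ?sqr_ge0 // ltW.
move: NN; rewrite /C => NN.
rlra.
Qed.

End Merit.

(* The multiple [4 * alpha / c] of the monotonicity inequality is the one that
   makes the [d2] terms cancel. *)
Lemma dual_step_bound {R : realType} (c alpha gamma m q e2 D2 d2 : R) :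
  0 < c <= gamma -> 0 < alpha < gamma / 2 -> 0 <= e2 ->
  0 <= m + alpha * q - (alpha + c) * D2 -> 2 * q <= d2 + D2 ->
  (forall s t : R, 0 <= s ^+ 2 * D2 - 2 * s * t * m + t ^+ 2 * e2) ->
  m + alpha * q - c / 2 * D2 + alpha / 2 * (1 + 4 * alpha / c) * (D2 - d2)
    <= 3 * gamma / (2 * c ^+ 2) * e2 - c / 4 * D2.
Proof.
move=> /andP[c0 cg] /andP[a0 ag] e0 mono hq quad.
(* Collecting all other terms leaves [- (3 * alpha + c / 2) * D2]; Young's inequality with weight
   [k] spends this up to the margin [c / 4]. *)
pose L := 4 * alpha / c; pose k := c / 4 + 3 * alpha.
have L0 : 0 < L by rewrite !divr_gt0 ?mulr_gt0.
have k0 : 0 < k by rewrite /k; lra.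
have Lc : L * c = 4 * alpha by rewrite /L; field; rewrite gt_eqF.
have h1 : (1 + L) * m <= k * D2 + (1 + L) ^+ 2 / (4 * k) * e2.
  have k4 : 0 < 4 * k by lra.
  rewrite -(ler_pM2l k4).
  have -> : 4 * k * (k * D2 + (1 + L) ^+ 2 / (4 * k) * e2) =
      4 * k ^+ 2 * D2 + (1 + L) ^+ 2 * e2 by field; rewrite gt_eqF.
  by have := quad (2 * k) (1 + L); lra.
(* Here [c <= gamma] and [alpha < gamma / 2] enter; the comparison explains the middle term of
   [rho_of]. *)
have h2 : (1 + L) ^+ 2 / (4 * k) <= 3 * gamma / (2 * c ^+ 2).
  have c2 : 0 < 2 * c ^+ 2 by rewrite mulr_gt0 // exprn_gt0.
  rewrite ler_pdivrMr ?mulr_gt0 // mulrAC ler_pdivlMr //.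
  have -> : (1 + L) ^+ 2 * (2 * c ^+ 2) = 2 * (c + L * c) ^+ 2 by ring.
  rewrite Lc /k.
  have t1 : c * c <= gamma * c by rewrite ler_pM2r.
  have t2 : alpha * c <= alpha * gamma by rewrite ler_pM2l.
  have t3 : alpha * alpha <= alpha * (gamma / 2) by rewrite ler_pM2l // ltW.
  have t4 : 0 < gamma * c by rewrite mulr_gt0 //; lra.
  have t5 : 0 < gamma * alpha by rewrite mulr_gt0 //; lra.
  lra.
have h3 : (1 + L) ^+ 2 / (4 * k) * e2 <= 3 * gamma / (2 * c ^+ 2) * e2 by rewrite ler_wpM2r.
have h4 : 0 <= L * (m + alpha * q - (alpha + c) * D2) by rewrite mulr_ge0 // ltW.
have h5 : (1 + L) * alpha * (2 * q) <= (1 + L) * alpha * (d2 + D2).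
  by rewrite ler_pM2l // mulr_gt0 //; lra.
rewrite -/L; move: h1 h4 h5; rewrite /k => h1 h4 h5.
have E : L * ((alpha + c) * D2) = L * alpha * D2 + 4 * alpha * D2.
  by rewrite mulrA mulrDr Lc mulrDl.
lra.
Qed.

(** * One-step decrease of the merit function *)

Section DescentStep.
Context {R : realType} {n p s : nat}.
Variables (S : set 'cV[R]_n) (f : 'cV[R]_p -> \bar R) (g : 'cV[R]_s -> \bar R).
Variables (A : 'M[R]_(s, n)) (K : 'M[R]_(p, n)) (phi : 'cV[R]_n -> R).

(** Adds the descent inequality for [phi], the normal cone condition tested at [x1], the subgradient
    inequality of the conjugate of [f] at [y2], and that of the conjugate of [g] at the old point
    [z1], since [- a2] must be bounded above. *)
Lemma merit_descent_step (ell alpha gamma mu ta be a1 a2 b1 b2 : R)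
    x1 x2 y1 y2 z0 z1 z2 :
  (forall v, differentiable phi v) ->
  (forall v w, enorm (gradient phi v - gradient phi w) <= ell * enorm (v - w)) ->
  0 < alpha < gamma / 2 -> 0 < ta - alpha <= gamma ->
  let rho := rho_of A ell alpha gamma mu ta in
  S x1 ->
  normal_cone S x2 (rho *: (x1 - x2) - (gradient phi x1 - K^T *m y1 + A^T *m z1)) ->
  conjugate f y1 = b1%:E -> conjugate f y2 = b2%:E ->
  conjugate g z1 = a1%:E -> conjugate g z2 = a2%:E ->
  subdiff (conjugate f) y2 (K *m x2 + be *: (y1 - y2)) ->
  subdiff (conjugate g) z1 (A *m x1 + alpha *: z0 - ta *: z1) ->
  subdiff (conjugate g) z2 (A *m x2 + alpha *: z1 - ta *: z2) ->
  merit_value A K phi alpha ta x2 y2 z2 z1 a2 b2 + mu * enorm (x2 - x1) ^+ 2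
    + be * enorm (y2 - y1) ^+ 2 + (ta - alpha) / 4 * enorm (z2 - z1) ^+ 2
  <= merit_value A K phi alpha ta x1 y1 z1 z0 a1 b1.
Proof.
move=> dphi lip ag tag rho Sx1 [_ nx] fy1 fy2 gz1 gz2 sf sg1 sg2.
have h2 := descent_upper dphi lip x1 x2.
have h5 := subdiff_monotone sg2 sg1.
move: sf => /subdiffP[b]; rewrite fy2 => -[<-] /(_ y1); rewrite fy1 lee_fin => h3.
move: sg1 => /subdiffP[a]; rewrite gz1 => -[<-] /(_ z2); rewrite gz2 lee_fin => h4.
have h1 := nx x1 Sx1.
pose dx := x2 - x1; pose dy := y2 - y1; pose dz := z2 - z1; pose dw := z1 - z0.
have x2E : x2 = x1 + dx by rewrite /dx addrC subrK.
have y2E : y2 = y1 + dy by rewrite /dy addrC subrK.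
have z2E : z2 = z1 + dz by rewrite /dz addrC subrK.
have z0E : z0 = z1 - dw by rewrite /dw; vector_ring.
have x12 : x1 - x2 = - dx by rewrite opprB.
have y12 : y1 - y2 = - dy by rewrite opprB.
rewrite -/dx -/dy -/dz; rewrite -/dx in h2; rewrite -/dz in h4 h5.
rewrite x12 in h1; rewrite y12 in h3.
move: dx dy dz dw x2E y2E z2E z0E h1 h2 h3 h4 h5 {x12 y12}.
move=> dx dy dz dw x2E y2E z2E z0E h1 h2 h3 h4 h5.
have e2 := sqr_enorm_mulmx A dx; have := sqr_ge0 (enorm (A *m dx)).
move: (enorm (A *m dx) ^+ 2) (sqr_enorm (A *m dx)) e2 => E2 E2E e2 E20.
pose m := dot (A *m dx) dz; pose q := dot dw dz.
have B := @dual_step_bound R (ta - alpha) alpha gamma m q E2 (dot dz dz) (dot dw dw) tag ag E20.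
have {}B : m + alpha * q - (ta - alpha) / 2 * dot dz dz +
    alpha / 2 * (1 + 4 * alpha / (ta - alpha)) * (dot dz dz - dot dw dw) <=
    3 * gamma / (2 * (ta - alpha) ^+ 2) * E2 - (ta - alpha) / 4 * dot dz dz.
  apply: B.
  - move: h5; rewrite /m /q x2E z2E z0E mulmxDr !dotE; lra.
  - have := dot_ge0 (dw - dz); rewrite /q !dotE (dotC dz dw); lra.
  - move=> s' t; have := dot_ge0 (s' *: dz - t *: (A *m dx)).
    by rewrite E2E /m !dotE (dotC dz (A *m dx)); lra.
have gam : 0 <= 3 * gamma / (2 * (ta - alpha) ^+ 2).
  case/andP: tag => c0 cg; apply: divr_ge0; first lra.
  by rewrite mulr_ge0 // sqr_ge0.
(* The three terms of [rho] pay for the curvature of [phi], the decrease [mu], and the coupling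
   bounded by [sigma A * dot dx dx]. *)
have rE : rho * dot dx dx = ell / 2 * dot dx dx + mu * dot dx dx
    + 3 * gamma / (2 * (ta - alpha) ^+ 2) * (sigma A * dot dx dx).
  rewrite /rho /rho_of; field; case/andP: tag => c0 _; rewrite gt_eqF //.
have e3 := ler_wpM2l gam e2; rewrite sqr_enorm in e3.
move: rE e3 B; rewrite /merit_value -/(prox_weight alpha ta).
move: (3 * gamma / _) (prox_weight alpha ta) => G T rE e3 B.
move: h1 h2 h3 h4; rewrite !sqr_enorm.
rewrite x2E y2E z2E z0E !mulmxDr !dotE !dot_trmx.
rewrite (dotC y1 (K *m dx)) (dotC dz (A *m x1)) (dotC dz (A *m dx)).
rewrite (dotC dz z1) (dotC dw z1) -/m -/q => h1 h2 h3 h4.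
lra.
Qed.

End DescentStep.

(** * Cluster points of sequences and convergence of values *)

Section Subsequences.
Context {R : realType} {m : nat}.
Implicit Types (u : nat -> 'cV[R]_m) (l : 'cV[R]_m).

Definition seq_cluster u l := forall (e : R) N, 0 < e ->
  exists2 k, (N <= k)%N & enorm (u k - l) < e.

Lemma compact_seq_cluster (C : set 'cV[R]_m) u : compact C ->
  (forall k, C (u k)) -> exists2 l, C l & seq_cluster u l.
Proof.
move=> cC uC; have [|l [Cl ul]] := cC (u @ \oo) _; first by exists 0%N => // k _; exact: uC.
exists l => // e N e0.
have h1 : (u @ \oo) [set v | exists2 k, (N <= k)%N & v = u k].
  by exists N => // k /= Nk; exists k.
have h2 : nbhs l [set v | enorm (v - l) < e] by apply/nbhs_enormP; exists e.
have [_ [[k Nk ->] /= kl]] := ul _ _ h1 h2.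
by exists k.
Qed.

Lemma seq_cluster_subsequence u l : seq_cluster u l ->
  exists2 t : nat -> nat, (forall k, (k <= t k)%N) & (u \o t) @ \oo --> l.
Proof.
move=> ul.
have /choice[t tP] : forall k, exists i, (k <= i)%N /\ enorm (u i - l) < k.+1%:R^-1.
  move=> k; have k0 : 0 < k.+1%:R^-1 :> R by rewrite invr_gt0.
  by have [i ki il] := ul _ k k0; exists i.
exists t => [k|]; first by case: (tP k).
apply/cvg_enormP => e e0.
have [N _ HN] := near_infty_natSinv_lt (PosNum e0).
by exists N => k Nk /=; apply: lt_trans (HN k Nk); case: (tP k).
Qed.

(** The subgradient inequalities at [v] and at [v_ k] squeeze the values from both sides, where
    semicontinuity would control only one. *)
Lemma subdiff_value_cvg (h : 'cV[R]_m -> \bar R) (v_ p_ : nat -> 'cV[R]_m) v p :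
  (forall k, subdiff h (v_ k) (p_ k)) -> subdiff h v p ->
  v_ @ \oo --> v -> p_ @ \oo --> p ->
  (fun k => fine (h (v_ k))) @ \oo --> fine (h v).
Proof.
move=> hv_ /subdiffP[a ha hv] cv cp; rewrite ha /=.
have dv : (fun k => v_ k - v) @ \oo --> (0 : 'cV[R]_m).
  by rewrite -(subrr v); apply: cvgB => //; exact: cvg_cst.
apply: (@squeeze_cvgr _ _ _ _ (fun k => a + dot p (v_ k - v))
  (fun k => a + dot (p_ k) (v_ k - v))).
- near=> k; have /subdiffP[b hb hbv] := hv_ k; rewrite hb /=.
  have := hv (v_ k); have := hbv v; rewrite ha hb !lee_fin => h1 h2.
  by rewrite h2 /=; move: h1; rewrite !dotE; lra.
- rewrite -[X in _ --> X]addr0 -(dot0r p); apply: cvgD; first exact: cvg_cst.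
  by apply: cvg_dot => //; exact: cvg_cst.
- rewrite -[X in _ --> X]addr0 -(dot0r p); apply: cvgD; first exact: cvg_cst.
  exact: cvg_dot.
Unshelve. all: by end_near.
Qed.

End Subsequences.

Lemma rho_of_gt0 {R : realType} {n s} (A : 'M[R]_(s, n)) (ell alpha gamma mu a : R) :
  0 < ell -> 0 < gamma -> 0 < mu -> 0 < rho_of A ell alpha gamma mu a.
Proof.
move=> l0 g0 m0; rewrite /rho_of.
have : 0 <= 3 * sigma A * gamma / (2 * (a - alpha) ^+ 2).
  apply: divr_ge0; last by rewrite mulr_ge0 // sqr_ge0.
  by rewrite (mulr_ge0 _ (ltW g0)) // mulr_ge0 // sqr_ge0.
lra.
Qed.

(** * The phase with constant parameters *)

Section StationaryPhase.
Context {R : realType} {n p s : nat}.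
Variables (S : set 'cV[R]_n) (f : 'cV[R]_p -> \bar R) (g : 'cV[R]_s -> \bar R).
Variables (A : 'M[R]_(s, n)) (K : 'M[R]_(p, n)) (phi : 'cV[R]_n -> R).
Variables (ell alpha gamma mu ta lo hi : R) (beta : nat -> R).
Variables (x : nat -> 'cV[R]_n) (y : nat -> 'cV[R]_p) (z : nat -> 'cV[R]_s).
Hypothesis dphi : forall v, differentiable phi v.
Hypothesis ell0 : 0 < ell.
Hypothesis lip : forall v w,
  enorm (gradient phi v - gradient phi w) <= ell * enorm (v - w).
Hypotheses (pf : proper_convex_lsc f) (pg : proper_convex_lsc g).
Hypotheses (fi : interior (edom f) !=set0) (gi : interior (edom g) !=set0).
Hypothesis gess : essentially_strictly_convex g.
Hypothesis ag : 0 < alpha < gamma / 2.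
Hypothesis tag : 0 < ta - alpha <= gamma.
Hypothesis mu0 : 0 < mu.
Hypothesis lo0 : 0 < lo.
Hypothesis beta_bd : forall k, lo <= beta k <= hi.
Let rho := rho_of A ell alpha gamma mu ta.
Hypothesis xS : forall k, S (x k.+1).
Hypothesis xN : forall k, normal_cone S (x k.+1)
  (rho *: (x k - x k.+1) - (gradient phi (x k) - K^T *m y k + A^T *m z k)).
Hypothesis yD : forall k, subdiff (conjugate f) (y k.+1)
  (K *m x k.+1 + beta k *: (y k - y k.+1)).
Hypothesis zD : forall k, subdiff (conjugate g) (z k.+1)
  (A *m x k.+1 + alpha *: z k - ta *: z k.+1).

(** Indexing starts at [k.+1] because the starting point need not lie in [S] or in the domains; at
    later iterates the conjugates are finite, so [fine] loses nothing. *)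
Definition phase_value k := merit_value A K phi alpha ta (x k.+1) (y k.+1) (z k.+1)
  (z k) (fine (conjugate g (z k.+1))) (fine (conjugate f (y k.+1))).

Definition phase_point k :=
  col_mx (x k.+1) (col_mx (y k.+1) (col_mx (z k.+1) (z k))).

Definition phase_gap k : R :=
  enorm (x k.+1 - x k) + enorm (y k.+1 - y k) + enorm (z k.+1 - z k).

Notation H := phase_value.
Notation W := phase_point.
Notation D := phase_gap.
Notation merit_w := (merit_vec S f g A K phi alpha ta).

Lemma phase_conjugate_f k : conjugate f (y k.+1) = (fine (conjugate f (y k.+1)))%:E.
Proof. by have /subdiffP[b -> _] := yD k. Qed.

Lemma phase_conjugate_g k : conjugate g (z k.+1) = (fine (conjugate g (z k.+1)))%:E.
Proof. by have /subdiffP[b -> _] := zD k. Qed.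

Lemma phase_gap_ge0 k : 0 <= D k.
Proof. by rewrite !addr_ge0 ?enorm_ge0. Qed.

Lemma phase_merit k : merit_w (W k) = (H k)%:E.
Proof.
by rewrite merit_vec_col (meritE _ _ _ _ _ _ (xS k) (phase_conjugate_g k)
  (phase_conjugate_f k)).
Qed.

(** The division by 3 comes from bounding the square of a sum of three terms by three times the sum
    of their squares. *)
Lemma phase_decrease k :
  H k.+1 + Num.min mu (Num.min lo ((ta - alpha) / 4)) / 3 * D k.+1 ^+ 2 <= H k.
Proof.
have := merit_descent_step dphi lip ag tag (xS k) (xN k.+1) (phase_conjugate_f k)
  (phase_conjugate_f k.+1) (phase_conjugate_g k) (phase_conjugate_g k.+1)
  (yD k.+1) (zD k) (zD k.+1).
rewrite -!/(phase_value _); apply: le_trans; rewrite -!addrA lerD2l /phase_gap.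
set a := Num.min _ _.
have a1 : a <= mu by rewrite ge_min lexx.
have a2 : a <= beta k.+1.
  have /andP[h _] := beta_bd k.+1; apply: le_trans h.
  by rewrite /a ge_min orbC ge_min lexx.
have a3 : a <= (ta - alpha) / 4 by rewrite /a ge_min orbC ge_min lexx orbT.
have a0 : 0 < a.
  have /andP[h _] := tag; have h1 := mu0; have h2 := lo0.
  by rewrite /a !lt_min h1 h2 divr_gt0.
move: a0 a1 a2 a3; clearbody a.
move: (enorm (x _ - _)) (enorm (y _ - _)) (enorm (z _ - _)) => X Y Z a0 a1 a2 a3.
have hX : a * X ^+ 2 <= mu * X ^+ 2 by rewrite ler_wpM2r // sqr_ge0.
have hY : a * Y ^+ 2 <= beta k.+1 * Y ^+ 2 by rewrite ler_wpM2r // sqr_ge0.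
have hZ : a * Z ^+ 2 <= (ta - alpha) / 4 * Z ^+ 2 by rewrite ler_wpM2r // sqr_ge0.
have h : (X + Y + Z) ^+ 2 <= 3 * (X ^+ 2 + Y ^+ 2 + Z ^+ 2).
  have := sqr_ge0 (X - Y); have := sqr_ge0 (Y - Z); have := sqr_ge0 (X - Z).
  by rewrite !expr2; lra.
have a3' : 0 < a / 3 by lra.
have : a / 3 * (X + Y + Z) ^+ 2 <= a / 3 * (3 * (X ^+ 2 + Y ^+ 2 + Z ^+ 2)).
  by rewrite ler_pM2l.
rewrite !addrA; lra.
Qed.

(** The last two blocks of [W] move by consecutive dual increments, hence the two gaps. *)
Lemma phase_step k : enorm (W k.+1 - W k) <= D k.+1 + D k.
Proof.
rewrite /phase_point !opp_col_mx !add_col_mx.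
have h1 := enorm_col_mx (x k.+2 - x k.+1)
  (col_mx (y k.+2 - y k.+1) (col_mx (z k.+2 - z k.+1) (z k.+1 - z k))).
have h2 := enorm_col_mx (y k.+2 - y k.+1) (col_mx (z k.+2 - z k.+1) (z k.+1 - z k)).
have h3 := enorm_col_mx (z k.+2 - z k.+1) (z k.+1 - z k).
have := enorm_ge0 (x k.+1 - x k); have := enorm_ge0 (y k.+1 - y k).
rewrite /phase_gap; lra.
Qed.

(** The optimality conditions of step [k], inserted into [merit_frechet], turn every block into
    increments of the iterates or of the gradient from [k] to [k.+1]. *)
Lemma phase_subgradient : exists2 b : R, 0 < b & forall k, exists2 V,
  frechet_subdiff merit_w (W k) V & enorm V <= b * D k.
Proof.
have /andP[a0 _] := ag; have /andP[c0 _] := tag; have l0 := ell0.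
have ta0 : alpha < ta by lra.
have T0 := prox_weight_ge0 a0 ta0.
have rho0 : 0 < rho by apply: rho_of_gt0 => //; have /andP[] := ag; lra.
have hi0 : 0 < hi by have /andP[h1 h2] := beta_bd 0; have := lo0; lra.
have oA := opnorm_ge0 A^T; have oK := opnorm_ge0 K^T.
pose b := opnorm A^T + opnorm K^T + ell + rho + hi + alpha + 4 * prox_weight alpha ta.
exists b; first by rewrite /b; lra.
have fN : forall v, (-oo < conjugate f v)%E by apply: conjugate_gtNy; case: pf.
move=> k; have F := @merit_frechet R n p s S f g A K phi alpha ta dphi ell ell0 lip
  fN pg gi gess a0 ta0 (x k.+1) (y k.+1) (z k.+1) (z k) _ _ _ (xS k) (xN k) (yD k) (zD k).
eexists; first exact: F.
set V1 := (X in col_mx X _); set V2 := (X in col_mx V1 (col_mx X _)).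
set V3 := (X in col_mx V1 (col_mx V2 (col_mx X _))).
set V4 := (X in col_mx V1 (col_mx V2 (col_mx V3 X))).
have h1 := enorm_col_mx V1 (col_mx V2 (col_mx V3 V4)).
have h2 := enorm_col_mx V2 (col_mx V3 V4).
have h3 := enorm_col_mx V3 V4.
set X := enorm (x k.+1 - x k); set Y := enorm (y k.+1 - y k).
set Z := enorm (z k.+1 - z k).
have e1 : enorm V1 <= opnorm A^T * Z + ell * X + opnorm K^T * Y + rho * X.
  have -> : V1 = A^T *m (z k.+1 - z k) + (gradient phi (x k.+1) - gradient phi (x k))
      - K^T *m (y k.+1 - y k) - rho *: (x k.+1 - x k).
    by rewrite /V1 !mulmxBr; vector_ring.
  have t1 := enorm_mulmx A^T (z k.+1 - z k).
  have t2 := lip (x k.+1) (x k).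
  have t3 := enorm_mulmx K^T (y k.+1 - y k).
  apply: le_trans (enormD _ _) _; rewrite enormN; apply: lerD.
    apply: le_trans (enormD _ _) _; rewrite enormN; apply: lerD => //.
    by apply: le_trans (enormD _ _) _; exact: lerD.
  by rewrite enormZ gtr0_norm.
have e2 : enorm V2 <= hi * Y.
  have -> : V2 = - (beta k *: (y k.+1 - y k)) by rewrite /V2; vector_ring.
  have /andP[b1 b2] := beta_bd k; have b0 := lo0.
  rewrite enormN enormZ gtr0_norm; last lra.
  by rewrite ler_wpM2r ?enorm_ge0.
have e3 : enorm V3 <= (alpha + 2 * prox_weight alpha ta) * Z.
  have -> : V3 = (alpha + 2 * prox_weight alpha ta) *: (z k.+1 - z k).
    by rewrite /V3; vector_ring.
  by rewrite enormZ ger0_norm //; lra.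
have e4 : enorm V4 <= 2 * prox_weight alpha ta * Z.
  by rewrite /V4 enormZ enormB ger0_norm //; lra.
have X0 : 0 <= X := enorm_ge0 _; have Y0 : 0 <= Y := enorm_ge0 _.
have Z0 : 0 <= Z := enorm_ge0 _.
rewrite /phase_gap -/X -/Y -/Z /b.
apply: (@le_trans _ _ ((opnorm A^T * Z + ell * X + opnorm K^T * Y + rho * X) + hi * Y
  + (alpha + 2 * prox_weight alpha ta) * Z + 2 * prox_weight alpha ta * Z)); first lra.
move: {h1 h2 h3 e1 e2 e3 e4} (opnorm A^T) (opnorm K^T) (prox_weight alpha ta) oA oK T0.
move=> oa ok T oa0 ok0 T0; move: rho rho0 => r r0.
have P (u v : R) : 0 <= u -> 0 <= v -> 0 <= u * v by exact: mulr_ge0.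
have := P _ _ oa0 X0; have := P _ _ oa0 Y0; have := P _ _ (ltW l0) Y0.
have := P _ _ (ltW l0) Z0; have := P _ _ ok0 X0; have := P _ _ ok0 Z0.
have := P _ _ (ltW r0) Y0; have := P _ _ (ltW r0) Z0; have := P _ _ (ltW hi0) X0.
have := P _ _ (ltW hi0) Z0; have := P _ _ (ltW a0) X0; have := P _ _ (ltW a0) Y0.
have := P _ _ T0 X0; have := P _ _ T0 Y0.
lra.
Qed.

Lemma phase_subdiff_f k :
  subdiff f (K *m x k.+1 + beta k *: (y k - y k.+1)) (y k.+1).
Proof. exact: subdiff_of_conjugate (yD k). Qed.

Lemma phase_subdiff_g k :
  subdiff g (A *m x k.+1 + alpha *: z k - ta *: z k.+1) (z k.+1).
Proof. exact: subdiff_of_conjugate (zD k). Qed.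

Lemma phase_nonincreasing k i : H (k + i) <= H k.
Proof.
elim: i => [|i IH]; first by rewrite addn0.
apply: le_trans IH; rewrite addnS; have := phase_decrease (k + i).
apply: le_trans; rewrite lerDl; apply: mulr_ge0; last exact: sqr_ge0.
have /andP[h _] := tag; have h1 := mu0; have h2 := lo0.
by rewrite divr_ge0 // !le_min !ltW // divr_gt0.
Qed.

Variables (r lr : R).
Hypotheses (r0 : 0 < r) (lr0 : 0 <= lr).
Hypothesis zB : forall k, enorm (z k) <= lr.
Hypothesis glip : lipschitz_const_on (enlargement S A r) g lr.
Hypothesis genl : enlargement S A r `<=` interior (edom g).
Hypothesis Kf : forall v, S v -> interior (edom f) (K *m v).
Hypothesis Sc : compact S.
Hypothesis finf : (-oo < ereal_inf [set objective f g A K phi v | v in S])%E.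

Lemma objective_lower_bound : exists M, forall v a b, S v ->
  g (A *m v) = a%:E -> f (K *m v) = b%:E -> M <= a + phi v - b.
Proof.
have lb v a b : S v -> g (A *m v) = a%:E -> f (K *m v) = b%:E ->
    (ereal_inf [set objective f g A K phi v | v in S] <= (a + phi v - b)%:E)%E.
  move=> Sv ga fb; apply: ereal_inf_lbound; exists v => //.
  by rewrite /objective ga fb.
move: finf lb; case: (ereal_inf _) => [M| |] // _ lb.
  by exists M => v a b Sv ga fb; rewrite -lee_fin; exact: lb.
(* An infinite infimum contradicts [lb], so any bound serves. *)
by exists 0 => v a b Sv ga fb; have := lb v a b Sv ga fb.
Qed.

(** Fenchel-Young removes [y]; the conjugate of [g] is evaluated exactly through its subgradient
    [P], and the Lipschitz minorant compares [g P] with [g (A *m x k.+1)]. What remains is the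
    objective on [S] up to terms bounded through [lr]. *)
Lemma phase_lower_bound : exists M, forall k, M <= H k.
Proof.
have [M0 HM0] := objective_lower_bound.
have [[gN _] gc _] := pg; have [[fN _] fc _] := pf.
have /andP[a0 _] := ag; have /andP[c0 _] := tag.
exists (M0 - 2 * (lr * ((alpha + ta) * lr)) - (ta - alpha) / 2 * lr ^+ 2) => k.
have enl w : enorm (w - A *m x k.+1) <= r -> enlargement S A r w.
  exact: enlargementI (xS k).
have gAv : (g (A *m x k.+1) < +oo)%E.
  have : edom g (A *m x k.+1).
    by apply: interior_subset; apply/genl/enl; rewrite subrr enorm0 ltW.
  by [].
have [a ga] : exists a, g (A *m x k.+1) = a%:E.
  by move: (gN (A *m x k.+1)) gAv; case: (g _) => [a| |] //; exists a.
have [b fb] : exists b, f (K *m x k.+1) = b%:E.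
  have : (f (K *m x k.+1) < +oo)%E := interior_subset (Kf (xS k)).
  by move: (fN (K *m x k.+1)); case: (f _) => [b| |] //; exists b.
have F := HM0 _ _ _ (xS k) ga fb.
rewrite /phase_value /merit_value.
have := conjugate_ge f (K *m x k.+1) (y k.+1).
rewrite fb phase_conjugate_f -EFinB lee_fin (dotC (y k.+1)) => hf.
have sg := phase_subdiff_g k.
have /subdiffP[c gp _] := sg.
rewrite (conjugate_subdiff gp sg) /=.
have := lipschitz_minorant gc gN glip ga r0 enl (A *m x k.+1 + alpha *: z k - ta *: z k.+1).
rewrite gp lee_fin => hc.
set P := A *m x k.+1 + alpha *: z k - ta *: z k.+1 in hc *.
have Pn : enorm (P - A *m x k.+1) <= (alpha + ta) * lr.
  have -> : P - A *m x k.+1 = alpha *: z k - ta *: z k.+1 by rewrite /P; vector_ring.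
  apply: le_trans (enormD _ _) _; rewrite enormN !enormZ mulrDl.
  rewrite !gtr0_norm //; last lra.
  by apply: lerD; rewrite ler_pM2l //; lra.
have h1 : lr * enorm (P - A *m x k.+1) <= lr * ((alpha + ta) * lr).
  by rewrite ler_wpM2l.
have h2 : dot (z k.+1) (P - A *m x k.+1) <= lr * ((alpha + ta) * lr).
  apply: le_trans (dot_le_enorm _ _) _; apply: ler_pM => //; exact: enorm_ge0.
have h3 : 0 <= prox_weight alpha ta * enorm (z k.+1 - z k) ^+ 2.
  by rewrite mulr_ge0 ?sqr_ge0 // prox_weight_ge0 //; lra.
have h4 : (ta - alpha) / 2 * enorm (z k.+1) ^+ 2 <= (ta - alpha) / 2 * lr ^+ 2.
  by rewrite ler_wpM2l // ?ler_sqr ?nnegrE ?enorm_ge0 //; lra.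
move: h2; rewrite dotDr dotNr => h2.
rlra.
Qed.

Lemma phase_value_cvg : exists Hs, (forall k, Hs <= H k) /\
  forall e : R, 0 < e -> exists N, forall k, (N <= k)%N -> H k < Hs + e.
Proof.
have [M HM] := phase_lower_bound.
have hi_ : has_inf (range H).
  by split; [exists (H 0), 0%N|exists M => _ [k _ <-]].
exists (inf (range H)); split=> [k|e e0].
  by apply: ge_inf; [case: hi_|exists k].
have [_ [N _ <-] HN] := inf_adherent e0 hi_.
exists N => k Nk; apply: le_lt_trans HN.
by rewrite -(subnKC Nk) phase_nonincreasing.
Qed.

Lemma phase_gap_cvg (e : R) : 0 < e ->
  exists N, forall k, (N <= k)%N -> D k < e.
Proof.
move=> e0; have [Hs [Hlow Hcvg]] := phase_value_cvg.
set a := Num.min mu (Num.min lo ((ta - alpha) / 4)) / 3.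
have a0 : 0 < a.
  have /andP[h _] := tag; have h1 := mu0; have h2 := lo0.
  by rewrite divr_gt0 // !lt_min h1 h2 divr_gt0.
have ae : 0 < a * e ^+ 2 by rewrite mulr_gt0 // exprn_gt0.
have [N HN] := Hcvg _ ae; exists N.+1 => -[//|k]; rewrite ltnS => Nk.
have := phase_decrease k; rewrite -/a => dk.
have h1 : a * D k.+1 ^+ 2 < a * e ^+ 2.
  by have := Hlow k.+1; have := HN k Nk; lra.
rewrite ltr_pM2l // in h1.
by rewrite -ltr_sqr ?nnegrE ?phase_gap_ge0 // ltW.
Qed.

(** Only infinitely many [y k.+1] are bounded here: when [x k.+1] is near a cluster point [xc] and
    the gap is small, [y k.+1] is a subgradient of [f] near [K *m xc], where the subdifferential is
    locally bounded. *)
Lemma phase_frequently_bounded :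
  exists B : R, forall N, exists2 k, (N <= k)%N & enorm (W k) <= B.
Proof.
have [xc Sxc cl] := compact_seq_cluster Sc xS.
have [[fN _] fc _] := pf.
have [d [B [d0 HB]]] := subdiff_locally_bounded fc fN (Kf Sxc).
have [CK CK0 HK] := enorm_mulmx_bound K.
have hi0 : 0 < hi by have /andP[h1 h2] := beta_bd 0; have := lo0; lra.
(* Half of the radius [d] goes to the displacement of [x] under [K], half to the perturbation by
   [beta]. *)
have dK : 0 < d / 2 / (CK + 1) by rewrite !divr_gt0 //; lra.
have [N1 HN1] := phase_gap_cvg (divr_gt0 (divr_gt0 d0 (ltr0n R 2)) hi0).
exists (enorm xc + d / 2 / (CK + 1) + B + lr + lr) => N.
have [k Nk xk] := cl _ (maxn N N1) dK.
move: Nk; rewrite geq_max => /andP[Nk N1k]; exists k => //.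
have yB : enorm (y k.+1) <= B.
  apply: HB _ _ _ (phase_subdiff_f k).
  have -> : K *m x k.+1 + beta k *: (y k - y k.+1) - K *m xc =
      K *m (x k.+1 - xc) + beta k *: (y k - y k.+1).
    by rewrite mulmxBr; vector_ring.
  apply: le_trans (enormD _ _) _.
  have t1 : enorm (K *m (x k.+1 - xc)) <= d / 2.
    apply: le_trans (HK _) _; move: xk; rewrite ltr_pdivlMr; last lra.
    by have := enorm_ge0 (x k.+1 - xc); lra.
  have t2 : enorm (beta k *: (y k - y k.+1)) <= d / 2.
    have /andP[b1 b2] := beta_bd k; have b0 := lo0.
    rewrite enormZ gtr0_norm; last lra.
    have Dk : enorm (y k - y k.+1) <= D k.
      rewrite enormB /phase_gap; have := enorm_ge0 (x k.+1 - x k).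
      have := enorm_ge0 (z k.+1 - z k); lra.
    have := HN1 k N1k; rewrite ltr_pdivlMr // => Dk1.
    apply: le_trans (ltW Dk1); rewrite mulrC; apply: ler_pM => //.
      exact: enorm_ge0.
    lra.
  lra.
have xB : enorm (x k.+1) <= enorm xc + d / 2 / (CK + 1).
  have := enorm_triangle (x k.+1) xc 0; rewrite !subr0; lra.
have h1 := enorm_col_mx (x k.+1) (col_mx (y k.+1) (col_mx (z k.+1) (z k))).
have h2 := enorm_col_mx (y k.+1) (col_mx (z k.+1) (z k)).
have h3 := enorm_col_mx (z k.+1) (z k).
have z1 := zB k; have z2 := zB k.+1.
rewrite /phase_point; lra.
Qed.

Lemma phase_cluster : exists wb, seq_cluster W wb.
Proof.
have [B HB] := phase_frequently_bounded.
have /choice[t tP] : forall N, exists k, (N <= k)%N /\ enorm (W k) <= B.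
  by move=> N; have [k] := HB N; exists k.
have cB : compact [set v : 'cV[R]_(n + (p + (s + s))) | enorm (v - 0) <= B].
  apply: (@enorm_ball_compact _ _ _ B); first exact: closed_enorm_ball.
  by move=> v /=; rewrite subr0.
have [k|wb _ cl] := @compact_seq_cluster _ _ _ (W \o t) cB.
  by rewrite /= subr0; case: (tP k).
exists wb => e N e0; have [k Nk kw] := cl e N e0.
by exists (t k) => //; apply: leq_trans Nk _; case: (tP k).
Qed.

Lemma phase_gap_x k : enorm (x k.+1 - x k) <= D k.
Proof.
have := enorm_ge0 (y k.+1 - y k); have := enorm_ge0 (z k.+1 - z k).
rewrite /phase_gap; lra.
Qed.

Lemma phase_gap_y k : enorm (y k.+1 - y k) <= D k.
Proof.
have := enorm_ge0 (x k.+1 - x k); have := enorm_ge0 (z k.+1 - z k).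
rewrite /phase_gap; lra.
Qed.

Lemma phase_gap_z k : enorm (z k.+1 - z k) <= D k.
Proof.
have := enorm_ge0 (x k.+1 - x k); have := enorm_ge0 (y k.+1 - y k).
rewrite /phase_gap; lra.
Qed.

Section LimitPoint.
Variables (t : nat -> nat) (xb : 'cV[R]_n) (yb : 'cV[R]_p) (zb : 'cV[R]_s).
Hypothesis tk : forall k, (k <= t k)%N.
Hypothesis cx : (fun k => x (t k).+1) @ \oo --> xb.
Hypothesis cy : (fun k => y (t k).+1) @ \oo --> yb.
Hypothesis cz : (fun k => z (t k).+1) @ \oo --> zb.

Lemma phase_shift_cvg m (v : nat -> 'cV[R]_m) (vb : 'cV[R]_m) :
  (forall k, enorm (v k.+1 - v k) <= D k) ->
  (fun k => v (t k).+1) @ \oo --> vb -> (fun k => v (t k)) @ \oo --> vb.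
Proof.
move=> vD /cvg_enormP cv; apply/cvg_enormP => e e0.
have e2 : 0 < e / 2 by rewrite divr_gt0.
have [N1 HN1] := cv _ e2; have [N2 HN2] := phase_gap_cvg e2.
exists (maxn N1 N2) => k; rewrite geq_max => /andP[k1 k2].
have := enorm_triangle (v (t k)) (v (t k).+1) vb.
have := HN1 k k1; have := HN2 _ (leq_trans k2 (tk k)); have := vD (t k).
rewrite (enormB (v (t k)) (v (t k).+1)); lra.
Qed.

Let cx0 := phase_shift_cvg phase_gap_x cx.
Let cy0 := phase_shift_cvg phase_gap_y cy.
Let cz0 := phase_shift_cvg phase_gap_z cz.

Lemma phase_limit_S : S xb.
Proof.
have clS : closed S by apply: compact_closed Sc; exact: norm_hausdorff.
apply: clS => Q /cx Qx.
have [N _ HN] : \forall k \near \oo, Q (x (t k).+1) := Qx.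
by exists (x (t N).+1); split; [exact: xS|exact: (HN N (leqnn N))].
Qed.

Lemma phase_limit_normal :
  normal_cone S xb (K^T *m yb - A^T *m zb - gradient phi xb).
Proof.
split; first exact: phase_limit_S.
move=> c Sc'.
have cn : (fun k => rho *: (x (t k) - x (t k).+1) - (gradient phi (x (t k))
    - K^T *m y (t k) + A^T *m z (t k))) @ \oo -->
    rho *: (xb - xb) - (gradient phi xb - K^T *m yb + A^T *m zb).
  apply: cvgB; first by apply: cvgZ; [exact: cvg_cst|exact: cvgB].
  apply: cvgD; first by apply: cvgB; [exact: (gradient_cvg ell0 lip)|exact: cvg_mulmx].
  exact: cvg_mulmx.
have -> : K^T *m yb - A^T *m zb - gradient phi xb =
    rho *: (xb - xb) - (gradient phi xb - K^T *m yb + A^T *m zb).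
  by vector_ring.
have cc : (fun k => c - x (t k).+1) @ \oo --> c - xb.
  exact: (cvgB (cvg_cst c) cx).
apply: (cvgr_to_le (cvg_dot cn cc)).
by exists 0%N => // k _ /=; have [_] := xN (t k); apply.
Qed.

Let cq : (fun k => K *m x (t k).+1 + beta (t k) *: (y (t k) - y (t k).+1)) @ \oo -->
  K *m xb.
Proof.
rewrite -[X in _ --> X]addr0; apply: cvgD; first exact: cvg_mulmx.
apply/cvg_enormP => e e0.
have hi0 : 0 < hi by have /andP[h1 h2] := beta_bd 0; have := lo0; lra.
have [N HN] := phase_gap_cvg (divr_gt0 e0 hi0).
exists N => k Nk; rewrite subr0 enormZ.
have /andP[b1 b2] := beta_bd (t k); have b0 := lo0.
have := HN _ (leq_trans Nk (tk k)); rewrite ltr_pdivlMr // => Dk.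
apply: le_lt_trans Dk; rewrite gtr0_norm ?(lt_le_trans b0) // mulrC.
apply: ler_pM => //; first exact: enorm_ge0.
  by rewrite (le_trans (ltW b0)).
by rewrite enormB phase_gap_y.
Qed.

Let cp : (fun k => A *m x (t k).+1 + alpha *: z (t k) - ta *: z (t k).+1) @ \oo -->
  A *m xb - (ta - alpha) *: zb.
Proof.
have -> : A *m xb - (ta - alpha) *: zb = A *m xb + alpha *: zb - ta *: zb.
  by vector_ring.
apply: cvgB; last by apply: cvgZ => //; exact: cvg_cst.
by apply: cvgD; [exact: cvg_mulmx|apply: cvgZ => //; exact: cvg_cst].
Qed.

(** Closedness is applied on the side of [f], whose lower semicontinuity is given, and the inclusion
    is then transferred to the conjugate. *)
Lemma phase_limit_f : subdiff (conjugate f) yb (K *m xb).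
Proof.
have [prf _ lf] := pf.
apply: subdiff_conjugate.
exact: (subdiff_closed prf lf (fun k => phase_subdiff_f (t k)) cq cy).
Qed.

Lemma phase_limit_g : subdiff (conjugate g) zb (A *m xb - (ta - alpha) *: zb).
Proof.
have [prg _ lg] := pg.
apply: subdiff_conjugate.
exact: (subdiff_closed prg lg (fun k => phase_subdiff_g (t k)) cp cz).
Qed.

(** Identifies the limit of [H] with the merit at the cluster point, as the KL inequality requires;
    the conjugates converge in value by [subdiff_value_cvg]. *)
Lemma phase_limit_value : (fun k => H (t k)) @ \oo -->
  merit_value A K phi alpha ta xb yb zb zb (fine (conjugate g zb))
    (fine (conjugate f yb)).
Proof.
have cphi : (fun k => phi (x (t k).+1)) @ \oo --> phi xb.
  exact: (cvg_comp _ phi cx (differentiable_continuous (dphi xb))).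
have csq m (v_ : nat -> 'cV[R]_m) (v : 'cV[R]_m) : v_ @ \oo --> v ->
    (fun k => enorm (v_ k) ^+ 2) @ \oo --> enorm v ^+ 2.
  by move=> cv; rewrite sqr_enorm; under eq_fun do rewrite sqr_enorm; exact: cvg_dot.
have cg := subdiff_value_cvg (fun k => zD (t k)) phase_limit_g cz cp.
have cf := subdiff_value_cvg (fun k => yD (t k)) phase_limit_f cy cq.
rewrite /phase_value /merit_value.
apply: cvgB; last first.
  by apply: cvgM; [exact: cvg_cst|exact: csq].
apply: cvgD; last first.
  by apply: cvgM; [exact: cvg_cst|apply: csq; exact: cvgB].
apply: cvgD => //; apply: cvgB; last by apply: cvg_dot => //; exact: cvg_mulmx.
apply: cvgD => //; apply: cvgB => //.
by apply: cvg_dot => //; exact: cvg_mulmx.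
Qed.

End LimitPoint.

(** The optimality conditions at a cluster point [wb] exhibit a Frechet subgradient of the merit
    function there, so the KL hypothesis applies and [KL_capture] upgrades clustering to
    convergence. *)
Lemma phase_convergence :
  (forall w, dom_limiting_subdiff merit_w w -> KL_property (merit_region g) merit_w w) ->
  exists xb yb zb, [/\ (fun k => x k.+1) @ \oo --> xb, (fun k => y k.+1) @ \oo --> yb,
    (fun k => z k.+1) @ \oo --> zb &
    [/\ normal_cone S xb (K^T *m yb - A^T *m zb - gradient phi xb),
        subdiff (conjugate f) yb (K *m xb) &
        subdiff (conjugate g) zb (A *m xb - (ta - alpha) *: zb)]].
Proof.
move=> KLp; have [wb cl] := phase_cluster.
have [t tk ct] := seq_cluster_subsequence cl.
pose xb := usubmx wb; pose yb := usubmx (dsubmx wb).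
pose zb := usubmx (dsubmx (dsubmx wb)).
have cx : (fun k => x (t k).+1) @ \oo --> xb.
  by have := cvg_usubmx ct; under eq_fun do rewrite /= /phase_point col_mxKu.
have cy : (fun k => y (t k).+1) @ \oo --> yb.
  have := cvg_usubmx (cvg_dsubmx ct).
  by under eq_fun do rewrite /= /phase_point col_mxKd col_mxKu.
have cz : (fun k => z (t k).+1) @ \oo --> zb.
  have := cvg_usubmx (cvg_dsubmx (cvg_dsubmx ct)).
  by under eq_fun do rewrite /= /phase_point !col_mxKd col_mxKu.
have cz' : (fun k => z (t k)) @ \oo --> dsubmx (dsubmx (dsubmx wb)).
  have := cvg_dsubmx (cvg_dsubmx (cvg_dsubmx ct)).
  by under eq_fun do rewrite /= /phase_point !col_mxKd.
(* The last two blocks of [W] have the same limit because the gaps vanish. *)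
have zE : dsubmx (dsubmx (dsubmx wb)) = zb.
  apply: cvg_unique cz' (phase_shift_cvg tk phase_gap_z cz).
  exact: norm_hausdorff.
have wE : wb = col_mx xb (col_mx yb (col_mx zb zb)) by rewrite -{2}zE !vsubmxK.
have Sxb := phase_limit_S cx.
have Nxb := phase_limit_normal tk cx cy cz.
have sf := phase_limit_f tk cx cy.
have sg := phase_limit_g tk cx cz.
have [Hs [Hlow Hcvg]] := phase_value_cvg.
set mv := merit_value A K phi alpha ta xb yb zb zb (fine (conjugate g zb))
  (fine (conjugate f yb)).
have HsE : Hs = mv.
  have c1 : (fun k => H (t k)) @ \oo --> Hs.
    apply/cvgrPdist_lt => e e0; have [N HN] := Hcvg e e0.
    exists N => // k /= Nk; rewrite distrC ger0_norm ?subr_ge0 //.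
    by have := HN _ (leq_trans Nk (tk k)); rewrite /=; lra.
  by apply: cvg_unique c1 (phase_limit_value tk cx cy cz); exact: norm_hausdorff.
have fyb : conjugate f yb = (fine (conjugate f yb))%:E by have /subdiffP[b0 ->] := sf.
have gzb : conjugate g zb = (fine (conjugate g zb))%:E by have /subdiffP[b0 ->] := sg.
have mE : merit_w wb = Hs%:E.
  by rewrite wE merit_vec_col (meritE _ _ _ _ _ _ Sxb gzb fyb) HsE.
have /andP[a0 _] := ag; have /andP[c0 _] := tag.
have ta0 : alpha < ta by lra.
have fN : forall v, (-oo < conjugate f v)%E by apply: conjugate_gtNy; case: pf.
have dom : dom_limiting_subdiff merit_w wb.
  eexists; apply: limiting_of_frechet; rewrite wE.
  exact: (@merit_frechet R n p s S f g A K phi alpha ta dphi ell ell0 lip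
    fN pg gi gess a0 ta0 xb yb zb zb _ _ _ Sxb Nxb sf sg).
have [eta [U [psi [eta0 [oU wU] _ dsg KLU]]]] := KLp _ dom.
have [e1 e10 HU] : exists2 e : R, 0 < e & forall w, enorm (w - wb) < e -> U w.
  by apply/nbhs_enormP; rewrite nbhsE; exists U.
have [b b0 HV] := phase_subgradient.
set a := Num.min mu (Num.min lo ((ta - alpha) / 4)) / 3.
have a00 : 0 < a.
  have h1 := mu0; have h2 := lo0.
  by rewrite divr_gt0 // !lt_min h1 h2 divr_gt0.
have cW : W @ \oo --> wb.
  apply: (@KL_capture R _ W wb D H Hs a b e1 eta psi) => //.
  - exact: phase_gap_ge0.
  - exact: phase_decrease.
  - exact: phase_step.
  - move=> k wk Hk Hke.
    have := KLU _ (HU _ wk); rewrite mE phase_merit lte_fin Hk /=.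
    have -> : ((H k)%:E < Hs%:E + eta)%E.
      by move: Hke; case: eta {eta0 dsg KLU} => [e| |] //; rewrite ?ltry // -EFinD !lte_fin; lra.
    move=> /(_ isT).
    have [_ _ _ _ /(_ (H k - Hs))] := dsg; rewrite subr_gt0 => /(_ Hk Hke) [_ _ P0].
    have [V FV VD] := HV k.
    (* The distance in the KL inequality is at most the norm of the explicit subgradient [V]. *)
    have dV : (dist_to 0 (limiting_subdiff merit_w (W k)) <= (b * D k)%:E)%E.
      apply: ge_ereal_inf; exists (enorm (0 - V))%:E.
        by exists V => //; exact: limiting_of_frechet.
      by rewrite sub0r enormN lee_fin.
    move=> h; rewrite -lee_fin EFinM; apply: le_trans h _.
    by apply: lee_wpmul2l => //; rewrite lee_fin ltW.
exists xb, yb, zb; split => //.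
- by have := cvg_usubmx cW; under eq_fun do rewrite /= /phase_point col_mxKu.
- have := cvg_usubmx (cvg_dsubmx cW).
  by under eq_fun do rewrite /= /phase_point col_mxKd col_mxKu.
- have := cvg_usubmx (cvg_dsubmx (cvg_dsubmx cW)).
  by under eq_fun do rewrite /= /phase_point !col_mxKd col_mxKu.
Qed.

End StationaryPhase.

(** * Boundedness of the dual iterates and the approximate KKT limit *)

Theorem theorem5p6 (R : realType) (n p s : nat)
  (S : set 'cV[R]_n)
  (f : 'cV[R]_p -> \bar R) (g : 'cV[R]_s -> \bar R)
  (A : 'M[R]_(s, n)) (K : 'M[R]_(p, n)) (phi : 'cV[R]_n -> R)
  (ell alpha gamma mu eps r lr leps : R)
  (al beta delta rho : nat -> R)
  (x : nat -> 'cV[R]_n) (y : nat -> 'cV[R]_p) (z : nat -> 'cV[R]_s) :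
  S !=set0 -> convex_set S -> compact S ->
  proper_convex_lsc f -> proper_convex_lsc g ->
  (forall v, differentiable phi v) ->
  0 < ell ->
  (forall v w, enorm (gradient phi v - gradient phi w) <= ell * enorm (v - w)) ->
  0 < sigma A ->
  [set A *m v | v in S] `<=` relint (edom g) ->
  (-oo < ereal_inf [set objective f g A K phi v | v in S])%E ->
  [set K *m v | v in S] `<=` relint (edom f) ->
  0 < r ->
  enlargement S A r `<=` interior (edom g) ->
  0 < lr -> lipschitz_const_on (enlargement S A r) g lr ->
  0 < gamma <= 2 * r / lr ->
  0 < alpha < gamma / 2 ->
  0 < mu ->
  enorm (z 0%N) <= lr ->
  essentially_strictly_convex g ->
  interior (edom f) !=set0 ->
  0 < eps <= r ->
  0 < leps -> lipschitz_const_on (enlargement S A eps) g leps ->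
  adaptive_DPFS S f g A K phi ell alpha gamma mu eps al beta delta rho x y z ->
  (forall (K0 : nat) (talpha : R),
     stationary_from A ell alpha gamma mu eps al delta rho z K0 talpha ->
     forall w, dom_limiting_subdiff (merit_vec S f g A K phi alpha talpha) w ->
       KL_property (merit_region g) (merit_vec S f g A K phi alpha talpha) w) ->
  exists (xb : 'cV[R]_n) (yb : 'cV[R]_p) (zb : 'cV[R]_s),
    [/\ x @ \oo --> xb, y @ \oo --> yb, z @ \oo --> zb &
        approx_KKT S f g A K phi (2 * leps * eps) xb yb zb].
Proof.
move=> S0 convS compS pf pg dphi ell0 lip _ _ finf Krel r0 genl lr0 glip gam alph mu0
  z0 gess fi epsr leps0 glipe algo KLp.
have /andP[gam0 gamr] := gam; have /andP[al0 alg] := alph.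
have /andP[eps0 epsle] := epsr.
have [prg gc _] := pg; have [prf _ _] := pf; have gN := prg.1.
have [v0 Sv0] := S0.
have gi : interior (edom g) !=set0.
  exists (A *m v0); apply/genl/(enlargementI Sv0).
  by rewrite subrr enorm0 ltW.
have Kf v : S v -> interior (edom f) (K *m v).
  by move=> Sv; apply: relint_interior fi _; apply: Krel; exists v.
have [xalg yalg zalg upd [lo [hi [lo0 betab]]] delE rhoE] := algo.
have alb k := adaptive_bounds gam0 upd k.
have alpos k : 0 < al k by have /andP[h _] := alb k; lra.
have beta0 k : 0 < beta k by have /andP[h _] := betab k; lra.
have xS k : S (x k.+1) by have [] := xalg k.
(* The relation [delta k = alpha / al k] turns [al k * delta k] into the constant [alpha]. *)
have zD k : subdiff (conjugate g) (z k.+1) (A *m x k.+1 + alpha *: z k - al k *: z k.+1).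
  have ak : (al k)^-1 > 0 by rewrite invr_gt0.
  have := prox_subdiff (econvex_conjugate prg) (eproper_conjugate pg gi) ak (zalg k).
  rewrite invrK delE; congr (subdiff _ _ _).
  move: (A *m x k.+1) => w; apply/matrixP => i j; rewrite !mxE; field.
  by rewrite gt_eqF.
have yD k : subdiff (conjugate f) (y k.+1) (K *m x k.+1 + beta k *: (y k - y k.+1)).
  have ak : (beta k)^-1 > 0 by rewrite invr_gt0.
  have := prox_subdiff (econvex_conjugate prf) (eproper_conjugate pf fi) ak (yalg k).
  rewrite invrK; congr (subdiff _ _ _).
  move: (K *m x k.+1) => w; apply/matrixP => i j; rewrite !mxE; field.
  by rewrite gt_eqF.
have rho0 k : 0 < rho k by rewrite rhoE; exact: rho_of_gt0.
have xN k : normal_cone S (x k.+1)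
    (rho k *: (x k - x k.+1) - (gradient phi (x k) - K^T *m y k + A^T *m z k)).
  have [Sx nx] := proj_normal_cone convS (xalg k); split=> // c Sc.
  have := nx c Sc; rewrite -(ler_pM2l (rho0 k)) mulr0 -dotZl; congr (dot _ _ <= _).
  move: (A^T *m z k) (K^T *m y k) => w1 w2; apply/matrixP => i j; rewrite !mxE; field.
  by rewrite gt_eqF.
(* Once [enorm (z k) <= lr], this leaves room for a ball of radius [r - alpha * lr] around
   [A *m x k.+1 + alpha *: z k] inside [enlargement S A r]. *)
have alr : alpha * lr < r by move: gamr; rewrite ler_pdivlMr // => gamr; nra.
have zB k : enorm (z k) <= lr.
  elim: k => [//|k IH].
  have e0 : 0 < r - alpha * lr by lra.
  apply: (@lipschitz_subgradient _ _ g (enlargement S A r) (A *m x k.+1 + alpha *: z k)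
    (A *m x k.+1 + alpha *: z k - al k *: z k.+1) _ _ (r - alpha * lr) (al k)) => //.
  - exact: ltW.
  - move=> v vb; apply: enlargementI (xS k) _.
    have := enorm_triangle v (A *m x k.+1 + alpha *: z k) (A *m x k.+1).
    rewrite [_ + _ - A *m _]addrC addKr enormZ gtr0_norm // => h.
    have : alpha * enorm (z k) <= alpha * lr by rewrite ler_pM2l.
    lra.
  - suff : edom g (A *m x k.+1 + alpha *: z k) by [].
    apply: interior_subset; apply/genl/(enlargementI (xS k)).
    rewrite addrC addKr enormZ gtr0_norm //.
    have : alpha * enorm (z k) <= alpha * lr by rewrite ler_pM2l.
    lra.
  - by rewrite opprB addrC subrK.
  - exact: subdiff_of_conjugate pg gi (zD k).
have [K0 [ta [tagt stat]]] := adaptive_stationary gam0 upd lr0 eps0 zB.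
have [alK _] := stat K0 (leqnn K0).
have tag : 0 < ta - alpha <= gamma.
  by have := alb K0; rewrite alK => /andP[h1 h2]; apply/andP; split; lra.
have sf : stationary_from A ell alpha gamma mu eps al delta rho z K0 ta.
  split=> // k Kk; have [alk tst] := stat k Kk.
  by rewrite delE rhoE -alk.
(* The results on the constant phase are applied to the sequences restarted at step [K0]. *)
have Kk k : (K0 <= k + K0)%N by rewrite leq_addl.
have xN' k : normal_cone S (x (k + K0).+1)
    (rho_of A ell alpha gamma mu ta *: (x (k + K0)%N - x (k + K0).+1) -
     (gradient phi (x (k + K0)%N) - K^T *m y (k + K0)%N + A^T *m z (k + K0)%N)).
  by have := xN (k + K0)%N; rewrite rhoE (stat _ (Kk k)).1.
have zD' k : subdiff (conjugate g) (z (k + K0).+1)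
    (A *m x (k + K0).+1 + alpha *: z (k + K0)%N - ta *: z (k + K0).+1).
  by have := zD (k + K0)%N; rewrite (stat _ (Kk k)).1.
have [xb [yb [zb [cx cy cz [Nx sfb sgb]]]]] :=
  @phase_convergence R n p s S f g A K phi ell alpha gamma mu ta lo hi
  (fun k => beta (k + K0)%N) (fun k => x (k + K0)%N) (fun k => y (k + K0)%N)
  (fun k => z (k + K0)%N) dphi ell0 lip pf pg fi gi gess alph tag mu0 lo0
  (fun k => betab (k + K0)%N) (fun k => xS (k + K0)%N) xN' (fun k => yD (k + K0)%N) zD'
  r lr r0 (ltW lr0) (fun k => zB (k + K0)%N) glip genl Kf compS finf (KLp _ _ sf).
have unshift m (u : nat -> 'cV[R]_m) (ub : 'cV[R]_m) :
    (fun k => u (k.+1 + K0)%N) @ \oo --> ub -> u @ \oo --> ub.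
  move=> cu; rewrite -(cvg_shiftn K0.+1); under eq_fun do rewrite addnS.
  exact: cu.
exists xb, yb, zb; split; [exact: unshift cx|exact: unshift cy|exact: unshift cz|].
split=> //; last first.
  by exists (K^T *m yb - A^T *m zb - gradient phi xb) => //; vector_ring.
have ta0 : 0 < ta - alpha by case/andP: tag.
(* The test fails at every step from [K0] on, and its negation passes to the limit. *)
have zeps : (ta - alpha) * enorm zb <= eps.
  apply/ler_addgt0Pr => e e0; have /cvg_enormP/(_ _ (divr_gt0 e0 ta0))[N HN] := cz.
  have := HN N (leqnn N); rewrite ltr_pdivlMr // => h1.
  have [alE h2] := stat _ (Kk N); rewrite alE in h2.
  have : (ta - alpha) * enorm zb <=
      (ta - alpha) * (enorm (z (N.+1 + K0)%N) + enorm (z (N.+1 + K0)%N - zb)).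
    rewrite ler_pM2l // addrC; have := enorm_triangle zb (z (N.+1 + K0)%N) 0.
    by rewrite !subr0 (enormB zb).
  move: h2; rewrite -addSn; lra.
set pb := A *m xb - (ta - alpha) *: zb in sgb.
have sgp := subdiff_of_conjugate pg gi sgb.
have [Sxb _] := Nx.
have pbn : enorm (pb - A *m xb) <= eps.
  have -> : pb - A *m xb = - ((ta - alpha) *: zb) by rewrite /pb; vector_ring.
  by rewrite enormN enormZ gtr0_norm.
have epb : enlargement S A eps pb by exact: enlargementI Sxb pbn.
have exb : enlargement S A eps (A *m xb).
  by apply: (enlargementI Sxb); rewrite subrr enorm0 ltW.
have /subdiffP[c gpb _] := sgp.
have [a ga] : exists a, g (A *m xb) = a%:E.
  have : edom g (A *m xb).
    by apply: interior_subset; apply/genl/(enlargementI Sxb); rewrite subrr enorm0 ltW.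
  by move: (gN (A *m xb)); rewrite /edom /=; case: (g _) => [a| |] //; exists a.
have gzb := conjugate_subdiff gpb sgp.
split; first by rewrite gzb.
(* The supremum at [w] is bounded below by its term at [A *m xb]; replacing [g pb] by [g (A *m xb)]
   costs at most [leps * eps], and the quadratic term in [zb] has the favourable sign. *)
move=> w; apply: le_trans (conjugate_ge g (A *m xb) w).
rewrite gzb ga -!EFinN -!EFinD lee_fin.
have := glipe _ _ exb epb; rewrite ga gpb lee_fin enormB ler_norml => /andP[_ h1].
have h2 : leps * enorm (pb - A *m xb) <= leps * eps by rewrite ler_pM2l.
have h3 : dot zb pb = dot zb (A *m xb) - (ta - alpha) * enorm zb ^+ 2.
  by rewrite /pb dotDr dotNr dotZr sqr_enorm.
have h4 : 0 <= (ta - alpha) * enorm zb ^+ 2 by rewrite mulr_ge0 ?sqr_ge0 // ltW.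
have h5 : 0 <= leps * eps by rewrite mulr_ge0 // ltW.
rewrite h3 dotDr dotNr (dotC (A *m xb) w) (dotC (A *m xb) zb); rlra.
Qed.
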